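(* Let $(M,\omega,h)$ be a regular Hamiltonian system with Hamiltonian vector field $X_h$, let $N>1$ be an integer, and let $Y\in\mathfrak{X}(M)$ be an infinitesimal Noether symmetry of order $N$, that is, $[Y,X_h]=0$, $L(Y)^N\omega=0$ and $L(Y)h=0$. Then: 1. The $1$-form $L(Y)^{N-1}\big(i(Y)\omega\big)\in\Omega^1(M)$ is closed. Consequently, for every $p\in M$ there is a neighborhood $U_p\ni p$ such that there exists $f\in C^\infty(U_p)$, unique up to a constant function, satisfying $L(Y)^{N-1}\big(i(Y)\omega\big)=\mathrm{d}f$ on $U_p$. 2. The function $f\in C^\infty(U_p)$ is a conserved quantity, that is, $L(X_h)f=0$ on $U_p$.
   Context: All manifolds are real, finite-dimensional, paracompact, connected and $C^\infty$; all maps are $C^\infty$. $\mathfrak{X}(M)$ is the set of smooth vector fields on $M$, $\Omega^1(M)$ the set of smooth $1$-forms on $M$, $i(Y)$ denotes contraction with the vector field $Y$, $L(Y)$ the Lie derivative along $Y$, and $L(Y)^N$ (written $L^N(Y)$ in some texts) its $N$-fold iterate. A regular Hamiltonian system is a triple $(M,\omega,h)$ where $(M,\omega)$ is a symplectic manifold and $h\in C^\infty(M)$ is the Hamiltonian function. Its Hamiltonian vector field $X_h\in\mathfrak{X}(M)$ is the unique vector field with $i(X_h)\omega=\mathrm{d}h$. A vector field $Y\in\mathfrak{X}(M)$ is an infinitesimal symmetry if $[Y,X_h]=0$. It is an infinitesimal Noether symmetry of order $N$ (for an integer $N>1$) if it is an infinitesimal symmetry, $L(Y)^N\omega=0$,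 and $L(Y)h=0$. A function $f$ is a conserved quantity (on the open set where it is defined) if $L(X_h)f=0$ there. *)

(* Defs.v *)
From HB Require Import structures.
From mathcomp Require Import all_boot all_order all_algebra.
From mathcomp Require Import all_classical all_reals all_analysis.
Set Implicit Arguments.
Unset Strict Implicit.
Unset Printing Implicit Defensive.
Import Order.TTheory GRing.Theory Num.Theory.
Import numFieldNormedType.Exports.
Local Open Scope classical_set_scope.
Local Open Scope ring_scope.

(* A smooth manifold is a topological space with an atlas, and a tensor field
   is the family of its component functions in the charts of the atlas, subject
   to smoothness and to the transformation law on overlaps.
   Vectors and covectors are rows, a bilinear form b is a matrix B with
   b(u, v) = u *m B *m v^T, and, as for the library's Jacobian,
   v *m 'J f x is the derivative of f at x along v, that is,
   ('J f x) i j = d f_j / d x_i.                                              *)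

Section EuclideanSmoothness.
Context {R : realType} {n : nat} {W : normedModType R}.

Definition partial_d (i : 'I_n) (f : 'rV[R]_n -> W) (x : 'rV[R]_n) : W :=
  'D_(delta_mx 0 i) f x.

Fixpoint Ck_on (k : nat) (U : set 'rV[R]_n) (f : 'rV[R]_n -> W) : Prop :=
  (forall x, U x -> {for x, continuous f}) /\
  (if k is k'.+1 then
     forall i : 'I_n, (forall x, U x -> derivable f x (delta_mx 0 i)) /\
                      Ck_on k' U (partial_d i f)
   else True).

(* Meant for open U; the values of f outside U are irrelevant.                *)
Definition smooth_on (U : set 'rV[R]_n) (f : 'rV[R]_n -> W) : Prop :=
  forall k, Ck_on k U f.

End EuclideanSmoothness.

Definition paracompact (T : topologicalType) : Prop :=
  forall C : set (set T),
    C `<=` open -> \bigcup_(A in C) A = [set: T] ->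
    exists D : set (set T),
      [/\ D `<=` open,
          \bigcup_(B in D) B = [set: T],
          forall B, D B -> exists2 A, C A & B `<=` A
        & forall x : T, exists2 V, nbhs x V &
            finite_set [set B | D B /\ B `&` V !=set0]].

(* A homeomorphism from the open set [dom] of T onto the open set [cod] of R^n,
   given by two total maps whose values off [dom] and [cod] are junk.         *)
Record chart (R : realType) (n : nat) (T : topologicalType) := Chart {
  dom : set T;
  cod : set 'rV[R]_n;
  to_coord : T -> 'rV[R]_n;
  of_coord : 'rV[R]_n -> T;
  dom_open : open dom;
  cod_open : open cod;
  to_coordP : forall p, dom p -> cod (to_coord p) /\ of_coord (to_coord p) = p;
  of_coordP : forall x, cod x -> dom (of_coord x) /\ to_coord (of_coord x) = x;
  to_coord_continuous : {within dom, continuous to_coord};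
  of_coord_continuous : {within cod, continuous of_coord}
}.

Section Transition.
Context {R : realType} {n : nat} {T : topologicalType}.
Implicit Types a b : chart R n T.

Definition overlap a b : set 'rV[R]_n :=
  [set x | cod a x /\ dom b (of_coord a x)].

Definition transition a b (x : 'rV[R]_n) : 'rV[R]_n :=
  to_coord b (of_coord a x).

End Transition.

Record manifold (R : realType) (n : nat) := Manifold {
  carrier :> topologicalType;
  chart_index : Type;
  atlas : chart_index -> chart R n carrier;
  manifold_hausdorff : hausdorff_space carrier;
  manifold_paracompact : paracompact carrier;
  manifold_connected : connected [set: carrier];
  atlas_cover : forall p : carrier, exists a, dom (atlas a) p;
  atlas_smooth : forall a b,
    smooth_on (overlap (atlas a) (atlas b)) (transition (atlas a) (atlas b))
}.

Arguments atlas {R n} m _.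

Section Tensors.
Context {R : realType} {n : nat} (M : manifold R n).
Local Notation I := (chart_index M).
Local Notation ch := (atlas M).

(* Families of component functions, one for each chart; only the values of the
   a-th function on the codomain of the chart a are meaningful.               *)
Definition components (V : Type) : Type := I -> 'rV[R]_n -> V.

Definition eq_on (V : Type) (O : set M) (s t : components V) : Prop :=
  forall a x, cod (ch a) x -> O (of_coord (ch a) x) -> s a x = t a x.

Definition smooth_components (V : normedModType R) (s : components V) : Prop :=
  forall a, smooth_on (cod (ch a)) (s a).

(* f in C^oo(O), O open; f is given by an arbitrary extension to M.           *)
Definition smooth_fun (O : set M) (f : M -> R) : Prop :=
  forall a, smooth_on [set x | cod (ch a) x /\ O (of_coord (ch a) x)]
                      (fun x => f (of_coord (ch a) x)).

Definition is_vector_field (X : components 'rV[R]_n) : Prop :=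
  smooth_components X /\
  forall a b x, overlap (ch a) (ch b) x ->
    X b (transition (ch a) (ch b) x)
      = X a x *m jacobian (transition (ch a) (ch b)) x.

Definition is_form1 (alpha : components 'rV[R]_n) : Prop :=
  smooth_components alpha /\
  forall a b x, overlap (ch a) (ch b) x ->
    alpha a x = alpha b (transition (ch a) (ch b) x)
                  *m (jacobian (transition (ch a) (ch b)) x)^T.

Definition is_form2 (omega : components 'M[R]_n) : Prop :=
  [/\ smooth_components omega,
      forall a x, cod (ch a) x -> (omega a x)^T = - omega a x
    & forall a b x, overlap (ch a) (ch b) x ->
        let J := jacobian (transition (ch a) (ch b)) x in
        omega a x = J *m omega b (transition (ch a) (ch b) x) *m J^T].

Definition d_fun (f : M -> R) : components 'rV[R]_n := fun a x =>
  \row_i partial_d i (fun y => f (of_coord (ch a) y)) x.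

Definition d_form1 (alpha : components 'rV[R]_n) : components 'M[R]_n :=
  fun a x =>
  \matrix_(i, j) (partial_d i (alpha a) x 0 j - partial_d j (alpha a) x 0 i).

Definition d_form2 (omega : components 'M[R]_n) :
    components ('I_n -> 'I_n -> 'I_n -> R) := fun a x i j k =>
  partial_d i (omega a) x j k + partial_d j (omega a) x k i
  + partial_d k (omega a) x i j.

Definition closed_form1 (alpha : components 'rV[R]_n) : Prop :=
  eq_on setT (d_form1 alpha) (fun _ _ => 0).

Definition closed_form2 (omega : components 'M[R]_n) : Prop :=
  eq_on setT (d_form2 omega) (fun _ _ _ _ _ => 0).

Definition interior_product
    (Y : components 'rV[R]_n) (omega : components 'M[R]_n) :
    components 'rV[R]_n := fun a x => Y a x *m omega a x.

Definition lie_fun (Y : components 'rV[R]_n) (f : M -> R) : components R :=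
  fun a x => 'D_(Y a x) (fun y => f (of_coord (ch a) y)) x.

Definition lie_bracket (Y X : components 'rV[R]_n) : components 'rV[R]_n :=
  fun a x => 'D_(Y a x) (X a) x - 'D_(X a x) (Y a) x.

(* (L_Y alpha)_i = Y^k d_k alpha_i + alpha_k d_i Y^k, so that
   Y (alpha X) = (L_Y alpha) X + alpha [Y, X].                                *)
Definition lie_form1 (Y alpha : components 'rV[R]_n) : components 'rV[R]_n :=
  fun a x => 'D_(Y a x) (alpha a) x + alpha a x *m (jacobian (Y a) x)^T.

(* (L_Y omega)_ij = Y^k d_k omega_ij + omega_kj d_i Y^k + omega_ik d_j Y^k, so
   that Y (omega (X, Z)) =
     (L_Y omega) (X, Z) + omega ([Y, X], Z) + omega (X, [Y, Z]).              *)
Definition lie_form2 (Y : components 'rV[R]_n) (omega : components 'M[R]_n) :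
    components 'M[R]_n := fun a x =>
  'D_(Y a x) (omega a) x + jacobian (Y a) x *m omega a x
  + omega a x *m (jacobian (Y a) x)^T.

Definition symplectic_form (omega : components 'M[R]_n) : Prop :=
  [/\ is_form2 omega, closed_form2 omega
    & forall a x, cod (ch a) x -> omega a x \in unitmx].

Definition regular_hamiltonian_system
    (omega : components 'M[R]_n) (h : M -> R) : Prop :=
  symplectic_form omega /\ smooth_fun setT h.

Definition hamiltonian_vector_field
    (omega : components 'M[R]_n) (h : M -> R) (X : components 'rV[R]_n) :
    Prop :=
  is_vector_field X /\ eq_on setT (interior_product X omega) (d_fun h).

Definition infinitesimal_symmetry (X Y : components 'rV[R]_n) : Prop :=
  is_vector_field Y /\ eq_on setT (lie_bracket Y X) (fun _ _ => 0).

Definition infinitesimal_noether_symmetry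
    (omega : components 'M[R]_n) (h : M -> R) (X Y : components 'rV[R]_n)
    (N : nat) : Prop :=
  [/\ infinitesimal_symmetry X Y,
      eq_on setT (iter N (lie_form2 Y) omega) (fun _ _ => 0)
    & eq_on setT (lie_fun Y h) (fun _ _ => 0)].

(* f in C^oo(O) and df = alpha on O.                                          *)
Definition potential_on (alpha : components 'rV[R]_n) (O : set M) (f : M -> R) :
    Prop :=
  smooth_fun O f /\ eq_on O (d_fun f) alpha.

Definition conserved_on (X : components 'rV[R]_n) (O : set M) (f : M -> R) :
    Prop :=
  eq_on O (lie_fun X f) (fun _ _ => 0).

End Tensors.

(* Main.v *)
(* Since omega is closed, Cartan's formula gives d(i(Y) omega) = L(Y) omega, and
   as d commutes with L(Y), d(L(Y)^(N-1) i(Y) omega) = L(Y)^N omega = 0.  A local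
   primitive on a coordinate ball is the radial integral of the Poincaré lemma.
   If df = L(Y)^(N-1) i(Y) omega, then L(X_h) f = i(X_h) L(Y)^(N-1) i(Y) omega;
   as [Y, X_h] = 0, i(X_h) commutes with L(Y), and the right-hand side becomes
   L(Y)^(N-1) applied to i(X_h) i(Y) omega = - L(Y) h = 0.  The tensors being
   given by components, the two identities are proved chart by chart; only the
   fact that L(Y) preserves 1-forms needs the chain rule and the symmetry of
   second derivatives of the transition maps. *)

Require Import Defs.
From HB Require Import structures.
From mathcomp Require Import all_boot all_order all_algebra.
From mathcomp Require Import all_classical all_reals all_analysis.
From mathcomp Require Import ring.
Set Implicit Arguments.
Unset Strict Implicit.
Unset Printing Implicit Defensive.
Import Order.TTheory GRing.Theory Num.Theory.
Import numFieldNormedType.Exports.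
Local Open Scope classical_set_scope.
Local Open Scope ring_scope.

(** * Calculus of C^k functions on open subsets of R^n *)

(** Smoothness is given by iterated partial derivatives, while the chain rule, ['J] and the
    linearity of ['D_v] in [v] need the Fréchet differential. Two classical theorems bridge the gap,
    both obtained from the mean value theorem along coordinate segments: continuous partials imply
    differentiability, and second partials commute. The latter also serves inside a single chart,
    for the components of Y and of the 1-form, when d is moved past L(Y). Components are junk off
    the chart, so every identity between them holds only on an open set. This is why identities are
    stated at all points of an open set and differentiated through [near_eq_derive]. Tensoriality of
    L(Y) matters for the local primitive: it is built in one chart, but its differential must be the
    given form in all charts. *)

Lemma open_near (T : topologicalType) (U : set T) (P : T -> Prop) x :
  open U -> U x -> (forall y, U y -> P y) -> \forall y \near x, P y.
Proof. by move=> oU Ux UP; apply: filterS (open_nbhs_nbhs (conj oU Ux)). Qed.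

Lemma near_eq_continuous (T S : topologicalType) (f g : T -> S) x :
  {near x, f =1 g} -> {for x, continuous f} -> {for x, continuous g}.
Proof.
move=> fg cf; rewrite /prop_for /continuous_at -(nbhs_singleton fg).
apply: cvg_trans cf; apply: (@near_eq_cvg _ _ (nbhs x)).
by apply: filterS fg => y ->.
Qed.

Section Ck.
Context {R : realType} {n : nat}.
Local Notation E := 'rV[R]_n.

Section Generic.
Context {W : normedModType R}.
Implicit Types (U : set E) (f g : E -> W).

Lemma Ck_on_ext k U f g : open U -> (forall x, U x -> f x = g x) ->
  Ck_on k U f -> Ck_on k U g.
Proof.
elim: k f g => [|k IH] f g oU fg /= [cf df]; split => //.
- by move=> x Ux; exact: (near_eq_continuous (open_near oU Ux fg) (cf x Ux)).
- by move=> x Ux; exact: (near_eq_continuous (open_near oU Ux fg) (cf x Ux)).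
move=> i; have [dfi Cfi] := df i; split=> [x Ux|].
  exact: (near_eq_derivable (open_near oU Ux fg) (dfi x Ux)).
apply: IH Cfi => // x Ux.
exact: (near_eq_derive _ (open_near oU Ux fg)).
Qed.

Lemma Ck_onS k U f : Ck_on k.+1 U f -> Ck_on k U f.
Proof.
elim: k f => [|k IH] f [cf df]; first by [].
by split => // i; have [? ?] := df i; split=> //; exact: IH.
Qed.

Lemma Ck_on_sub k U V f : V `<=` U -> Ck_on k U f -> Ck_on k V f.
Proof.
move=> VU; elim: k f => [|k IH] f [cf df]; split => //.
- by move=> x /VU; exact: cf.
- by move=> x /VU; exact: cf.
by move=> i; have [dfi ?] := df i; split=> [x /VU|]; [exact: dfi|exact: IH].
Qed.

Lemma smooth_on_ext U f g : open U -> (forall x, U x -> f x = g x) ->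
  smooth_on U f -> smooth_on U g.
Proof. by move=> oU fg sf k; apply: Ck_on_ext fg (sf k). Qed.

Lemma smooth_on_sub U V f : V `<=` U -> smooth_on U f -> smooth_on V f.
Proof. by move=> VU sf k; apply: Ck_on_sub (sf k). Qed.

Lemma smooth_on_continuous U f x : smooth_on U f -> U x -> {for x, continuous f}.
Proof. by move=> /(_ 0)[+ _]; apply. Qed.

Lemma smooth_on_derivable U f x i :
  smooth_on U f -> U x -> derivable f x (delta_mx 0 i).
Proof. by move=> /(_ 1)[_ /(_ i)[+ _]]; apply. Qed.

Lemma smooth_on_partial U f i : smooth_on U f -> smooth_on U (partial_d i f).
Proof. by move=> sf k; have [_ /(_ i)[]] := sf k.+1. Qed.

(** The converse of the three projections above; it lets smoothness be read off from a gradient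
    already known to be smooth. *)
Lemma smooth_onP U f : (forall x, U x -> {for x, continuous f}) ->
  (forall i x, U x -> derivable f x (delta_mx 0 i)) ->
  (forall i, smooth_on U (partial_d i f)) -> smooth_on U f.
Proof.
move=> cf df sf [|k]; split => // i; split; first exact: df.
exact: sf.
Qed.

Lemma Ck_on_cst k U (c : W) : Ck_on k U (cst c).
Proof.
elim: k c => [|k IH] c; split => //; try by move=> x _; exact: cst_continuous.
move=> i; split=> [x _|]; first exact: derivable_cst.
rewrite (_ : partial_d i _ = cst 0); first exact: IH.
by apply/funext => x; exact: derive_cst.
Qed.

Lemma Ck_onD k U f g : open U -> Ck_on k U f -> Ck_on k U g ->
  Ck_on k U (fun x => f x + g x).
Proof.
move=> oU; elim: k f g => [|k IH] f g [cf df] [cg dg]; split => //.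
- by move=> x Ux; apply: (@continuousD _ _ _ f g); [exact: cf|exact: cg].
- by move=> x Ux; apply: (@continuousD _ _ _ f g); [exact: cf|exact: cg].
move=> i; have [dfi Cfi] := df i; have [dgi Cgi] := dg i; split=> [x Ux|].
  by apply: (@derivableD _ _ _ f g); [exact: dfi|exact: dgi].
apply: Ck_on_ext (IH _ _ Cfi Cgi) => // x Ux.
by apply/esym/(@deriveD _ _ _ f g); [exact: dfi|exact: dgi].
Qed.

Lemma smooth_onD U f g : open U -> smooth_on U f -> smooth_on U g ->
  smooth_on U (fun x => f x + g x).
Proof. by move=> oU sf sg k; apply: Ck_onD. Qed.

Lemma smooth_on_cst U (c : W) : smooth_on U (cst c).
Proof. by move=> k; exact: Ck_on_cst. Qed.

Lemma smooth_on_sum (I : Type) (r : seq I) (P : pred I) U (f : I -> E -> W) :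
  open U -> (forall i, P i -> smooth_on U (f i)) ->
  smooth_on U (fun x => \sum_(i <- r | P i) f i x).
Proof.
move=> oU sf; elim: r => [|i r IH].
  by apply: smooth_on_ext (smooth_on_cst U 0) => // x _; rewrite big_nil.
case Pi: (P i); last by apply: smooth_on_ext IH => // x _; rewrite big_cons Pi.
by apply: smooth_on_ext (smooth_onD oU (sf i Pi) IH) => // x _; rewrite big_cons Pi.
Qed.

End Generic.

Lemma Ck_onM k (U : set E) (f g : E -> R) : open U ->
  Ck_on k U f -> Ck_on k U g -> Ck_on k U (fun x => f x * g x).
Proof.
move=> oU; elim: k f g => [|k IH] f g Cf Cg.
  have [[cf _] [cg _]] := (Cf, Cg); split=> // x Ux.
  by apply: (@continuousM _ _ f g); [exact: cf|exact: cg].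
have [[cf df] [cg dg]] := (Cf, Cg); split=> [x Ux|i].
  by apply: (@continuousM _ _ f g); [exact: cf|exact: cg].
have [dfi Cfi] := df i; have [dgi Cgi] := dg i; split=> [x Ux|].
  by apply: (@derivableM _ _ f g); [exact: dfi|exact: dgi].
apply: (@Ck_on_ext _ _ _ (fun x => f x * partial_d i g x + g x * partial_d i f x)) => //.
  by move=> x Ux; apply/esym/(@deriveM _ _ f g); [exact: dfi|exact: dgi].
by apply: Ck_onD => //; apply: IH => //; exact: Ck_onS.
Qed.

Lemma smooth_onM (U : set E) (f g : E -> R) : open U ->
  smooth_on U f -> smooth_on U g -> smooth_on U (fun x => f x * g x).
Proof. by move=> oU sf sg k; apply: Ck_onM. Qed.

End Ck.

(** * Restriction to lines and the mean value theorem *)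

Section Lines.
Context {R : realType} {V : normedModType R}.

(** The two difference quotients are the same function of [h], so derivability in the single
    direction [v] is enough. *)
Lemma is_derive_line (W : normedModType R) (f : V -> W) x v (t : R) :
  derivable f (x + t *: v) v ->
  is_derive t 1 (fun s : R => f (x + s *: v)) ('D_v f (x + t *: v)).
Proof.
have eqf : (fun h : R => h^-1 *: (((fun s : R => f (x + s *: v)) \o shift t) (h *: 1)
                               - f (x + t *: v))) =
   (fun h : R => h^-1 *: ((f \o shift (x + t *: v)) (h *: v) - f (x + t *: v))).
  apply/funext => h /=; congr (_ *: (f _ - _)).
  by rewrite [_%:A]mulr1 scalerDl addrCA.
by move=> df; split; rewrite /derivable /derive eqf.
Qed.

Lemma is_derive_of_line (W : normedModType R) (f : V -> W) x v l :
  is_derive (0 : R) (1 : R) (fun h : R => f (h *: v + x)) l -> is_derive x v f l.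
Proof.
have eqf : (fun h : R => h^-1 *: ((f \o shift x) (h *: v) - f x)) =
   (fun h : R => h^-1 *: (((fun s : R => f (s *: v + x)) \o shift 0) (h *: 1) - f (0 *: v + x))).
  by apply/funext => h /=; rewrite [_%:A]mulr1 addr0 scale0r add0r.
by move=> [df Df]; split; rewrite /derivable /derive eqf.
Qed.

(** Homogeneity in the direction, before any differentiability of [f] is known: restricted to the
    line, [f] is a derivable function of one real variable, hence differentiable, and its
    differential is linear. The case [c = 0] needs no separate treatment. *)
Lemma is_deriveZ_dir (W : normedModType R) (f : V -> W) x v (c : R) :
  derivable f x v -> is_derive x (c *: v) f (c *: 'D_v f x).
Proof.
move=> df; pose g (s : R) := f (x + s *: v).
have [dg Dg] : is_derive (0 : R) (1 : R) g ('D_v f (x + 0 *: v)).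
  by apply: is_derive_line; rewrite scale0r addr0.
have eqf : (fun h : R => h^-1 *: ((f \o shift x) (h *: (c *: v)) - f x)) =
   (fun h : R => h^-1 *: ((g \o shift 0) (h *: c) - g 0)).
  apply/funext => h /=; rewrite /g scale0r !addr0 scalerA.
  by congr (_ *: (f _ - _)); rewrite addrC.
have dg0 : differentiable g 0 by exact/derivable1_diffP.
split; rewrite /derivable /derive eqf; first exact: (@diff_derivable _ _ _ g 0 c dg0).
transitivity ('D_c g 0) => //.
rewrite deriveE // -[c in LHS]mulr1 -[c * 1]/(c *: (1 : R)) linearZ /= -deriveE //.
by rewrite Dg scale0r addr0.
Qed.

Lemma line_MVT (f : V -> R) x v :
  (forall t : R, 0 <= t <= 1 -> derivable f (x + t *: v) v) ->
  exists2 t : R, 0 <= t <= 1 & f (x + v) - f x = 'D_v f (x + t *: v).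
Proof.
move=> df; pose g (t : R) := f (x + t *: v).
have [||t] := @MVT_segment _ g (fun t => 'D_v f (x + t *: v)) 0 1 ler01.
- move=> t; rewrite in_itv /= => /andP[t0 t1]; apply: is_derive_line.
  by apply: df; rewrite !ltW.
- apply: derivable_within_continuous => t; rewrite in_itv /= => t01.
  by have [] := is_derive_line (df t t01).
rewrite in_itv /= /g scale1r scale0r addr0 subr0 mulr1 => t01 ft.
by exists t.
Qed.

End Lines.

(** * The sup norm of matrices and entrywise criteria *)

Section MatrixNorm.
Context {R : realType} {p q : nat}.
Implicit Types u : 'M[R]_(p, q).

Lemma mx_norm_le u (c : R) : 0 <= c -> (forall i j, `|u i j| <= c) -> `|u| <= c.
Proof.
move=> c0 uc; rewrite [leLHS]/Num.Def.normr /= mx_normrE.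
by apply: bigmax_le => // -[i j] _; exact: uc.
Qed.

Lemma mx_norm_ge u i j : `|u i j| <= `|u|.
Proof.
rewrite [leRHS]/Num.Def.normr /= mx_normrE.
exact: (le_bigmax _ (fun ij => `|u ij.1 ij.2|) (i, j)).
Qed.

Lemma continuous_mx (T : topologicalType) (f : T -> 'M[R]_(p, q)) x :
  (forall i j, {for x, continuous (fun y => f y i j)}) -> {for x, continuous f}.
Proof.
move=> cf; apply/cvgrPdist_le => e e0.
have : \forall y \near x, forall ij : 'I_p * 'I_q, `|f x ij.1 ij.2 - f y ij.1 ij.2| <= e.
  apply: filter_forall => -[i j] /=.
  by have /cvgrPdist_le := cf i j; apply.
apply: filterS => y fy; apply: mx_norm_le (ltW e0) _ => i j.
by rewrite !mxE; exact: (fy (i, j)).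
Qed.

Lemma differentiable_mx (V : normedModType R) (f : V -> 'M[R]_(p, q)) x :
  (forall i j, differentiable (fun y => f y i j) x) -> differentiable f x.
Proof.
move=> df.
rewrite (_ : f = \sum_(i < p) \sum_(j < q) (fun y => f y i j *: delta_mx i j)).
  apply: differentiable_sum => i; apply: differentiable_sum => j.
  exact: differentiableZl.
apply/funext => y; rewrite [LHS]matrix_sum_delta fct_sumE.
by apply: eq_bigr => i _; rewrite fct_sumE.
Qed.

End MatrixNorm.

(** For Schwarz's theorem: [P] and [Q] are the mixed derivatives at a point, [p] and [q] their
    values at nearby points where they agree. *)
Lemma dist_le_via (R : realType) (P Q p q h : R) :
  `|P - p| <= h -> `|Q - q| <= h -> p = q -> `|Q - P| <= h + h.
Proof.
move=> Pp Qq pq; apply: le_trans (ler_distD q Q P) _; apply: lerD => //.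
by rewrite -pq distrC.
Qed.

(** * Continuous partials: differentiability and Schwarz's theorem *)

Section C1.
Context {R : realType} {n : nat}.
Local Notation E := 'rV[R]_n.

Lemma norm_Zdelta_le (a : R) (i : 'I_n) : `|a *: delta_mx 0 i : E| <= `|a|.
Proof.
apply: mx_norm_le => // k j; rewrite !mxE ord1 eqxx /=.
by case: eqP => _; rewrite ?mulr1 // mulr0 normr0.
Qed.

(** The points [x + trunc_rV k h] are the corners of the staircase from [x] to [x + h] that moves
    one coordinate at a time. *)
Definition trunc_rV (k : nat) (h : E) : E := \row_j (if (j < k)%N then h 0 j else 0).

Lemma trunc_rVS (i : 'I_n) h : trunc_rV i.+1 h = trunc_rV i h + h 0 i *: delta_mx 0 i.
Proof.
apply/rowP => j; rewrite !mxE eqxx /= ltnS leq_eqVlt.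
have [->|ij] := eqVneq j i; first by rewrite eqxx ltnn add0r mulr1.
by rewrite -val_eqE /= in ij; rewrite (negbTE ij) /= mulr0 addr0.
Qed.

(** The norm is the sup norm, so the whole staircase stays within distance [|h|] of its start. *)
Lemma norm_trunc_rV_le (i : 'I_n) h (t : R) : 0 <= t <= 1 ->
  `|trunc_rV i h + t *: (h 0 i *: delta_mx 0 i)| <= `|h|.
Proof.
move=> /andP[t0 t1]; apply: mx_norm_le => // k j; rewrite !mxE ord1 eqxx /=.
have [->|ij] := eqVneq j i.
  rewrite ltnn add0r mulr1 normrM (ger0_norm t0).
  by apply: le_trans (mx_norm_ge h 0 i); rewrite ler_piMl.
rewrite mulr0 mulr0 addr0; case: ifP => _; first exact: mx_norm_ge.
by rewrite normr0.
Qed.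

(** Each step of the staircase is parallel to an axis, so the one-variable mean value theorem
    applies to it; the increments telescope. *)
Lemma increment_partials (f : E -> R) x h :
  (forall y i, `|y - x| <= `|h| -> derivable f y (delta_mx 0 i)) ->
  exists2 y : 'I_n -> E, (forall i, `|y i - x| <= `|h|) &
    f (x + h) - f x = \sum_i h 0 i * partial_d i f (y i).
Proof.
move=> df.
have /fin_all_exists2[y yh Dy] : forall i : 'I_n, exists2 y : E, `|y - x| <= `|h| &
    f (x + trunc_rV i.+1 h) - f (x + trunc_rV i h) = h 0 i * partial_d i f y.
  move=> i; pose v : E := h 0 i *: delta_mx 0 i.
  have xt (t : R) : 0 <= t <= 1 -> `|x + trunc_rV i h + t *: v - x| <= `|h|.
    by move=> t01; rewrite -(addrA x) (addrC x) addrK norm_trunc_rV_le.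
  have dfv t (t01 : 0 <= t <= 1) := is_deriveZ_dir (h 0 i) (df _ i (xt t t01)).
  have [|t t01 ft] := @line_MVT R _ f (x + trunc_rV i h) v.
    by move=> t /dfv[].
  exists (x + trunc_rV i h + t *: v); first exact: xt.
  by rewrite trunc_rVS addrA ft; have [_ ->] := dfv t t01.
exists y => //; pose F k := f (x + trunc_rV k h).
transitivity (\sum_(i < n) (F i.+1 - F i)); last by apply: eq_bigr => i _; exact: Dy.
rewrite -(big_mkord xpredT (fun i => F i.+1 - F i)) telescope_sumr //.
congr (f (x + _) - f _).
  by apply/rowP => j; rewrite !mxE ltn_ord.
by rewrite (_ : trunc_rV 0 h = 0) ?addr0 //; apply/rowP => j; rewrite !mxE.
Qed.

(** The increment minus the candidate differential is the sum of [h 0 i] times the variation of the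
    i-th partial between [x] and a nearby point; continuity of the partials makes it o(h). *)
Lemma continuous_partials_differentiable (U : set E) (f : E -> R) x :
  open U -> U x -> (forall i y, U y -> derivable f y (delta_mx 0 i)) ->
  (forall i, {for x, continuous (partial_d i f)}) -> differentiable f x.
Proof.
move=> oU Ux df cf.
pose L (h : E) : R := \sum_i h 0 i * partial_d i f x.
have linL : linear L.
  move=> a u v; rewrite /L scaler_sumr -big_split; apply: eq_bigr => i _ /=.
  by rewrite !mxE mulrDl -mulrA.
pose Ll : {linear E -> R} := HB.pack L (GRing.isLinear.Build R E R _ L linL).
have cL : continuous Ll.
  apply/(@linear_bounded_continuous R E R Ll)/linear_boundedP.
  near=> M => h; apply: le_trans (ler_norm_sum _ _ _) _.
  apply: (@le_trans _ _ ((\sum_i `|partial_d i f x|) * `|h|)).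
    rewrite mulr_suml; apply: ler_sum => i _; rewrite normrM mulrC.
    by apply: ler_wpM2l => //; exact: mx_norm_ge.
  by apply: ler_wpM2r => //; near: M; exact: nbhs_pinfty_ge.
have small (eps : R) : 0 < eps ->
    \forall h \near (0 : E), `|f (h + x) - (f x + L h)| <= eps * `|h|.
  move=> /[dup] eps0 /posnumP[e].
  (* There are [n] error terms; dividing by [n.+1] keeps the denominator nonzero when [n = 0]. *)
  pose e' := e%:num / n.+1%:R.
  have e'0 : 0 < e' by rewrite divr_gt0.
  have : \forall y \near x, U y /\ forall i, `|partial_d i f x - partial_d i f y| <= e'.
    apply: (@filterI _ (nbhs x)); first exact: (open_near oU Ux).
    apply: (@filter_forall E _ (fun i y => `|partial_d i f x - partial_d i f y| <= e') (nbhs x)) => i.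
    by have /cvgrPdist_le := cf i; apply.
  move=> /nbhs_normP[d /= d0 dP].
  near=> h.
  have hd : `|h| < d.
    by near: h; exact: (@nbhs0_lt R E d).
  have near_x y : `|y - x| <= `|h| ->
      U y /\ forall i, `|partial_d i f x - partial_d i f y| <= e'.
    by move=> yx; apply: dP; rewrite /= distrC (le_lt_trans yx).
  have [|y yh Dy] := @increment_partials f x h.
    by move=> y i /near_x[Uy _]; exact: df.
  rewrite opprD addrA (addrC h) Dy -sumrB.
  apply: le_trans (ler_norm_sum _ _ _) _.
  apply: (@le_trans _ _ (\sum_(i < n) `|h| * e')).
    apply: ler_sum => i _; rewrite -mulrBr normrM; apply: ler_pM => //.
      exact: mx_norm_ge.
    by rewrite distrC; have [_] := near_x _ (yh i); apply.
  rewrite sumr_const card_ord -mulrnAr (mulrC e%:num) ler_wpM2l // /e'.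
  rewrite -mulr_natr -mulrA ler_piMr //.
  by rewrite ler_pdivrMl // mulr1 ler_nat.
have oL := proj2 (@eqaddoP R E R E (nbhs_filter_on (0 : E)) (f \o shift x)
  (cst (f x) + (Ll : E -> R)) id) small.
have dE := diff_unique cL oL.
by apply/diff_locallyP; rewrite dE; split.
Unshelve. all: by end_near. Qed.

(** Mean value theorem twice: along the i-th axis for [y |-> f (y + s *: ej) - f y], then along the
    j-th axis for the i-th partial of [f]. Both intermediate points lie in the parallelogram spanned
    by the two steps, whence the bound [2|s|]. *)
Lemma second_increment (f : E -> R) (U : set E) i j x (s : R) :
  Ck_on 2 U f -> (forall y, `|y - x| <= `|s| *+ 2 -> U y) ->
  exists2 y, `|y - x| <= `|s| *+ 2 &
  f (x + s *: delta_mx 0 i + s *: delta_mx 0 j) - f (x + s *: delta_mx 0 i)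
    - (f (x + s *: delta_mx 0 j) - f x)
  = s * (s * partial_d j (partial_d i f) y).
Proof.
move=> Cf Us; set ei : E := delta_mx 0 i; set ej : E := delta_mx 0 j.
have bound (t u : R) : `|t| <= 1 -> `|u| <= 1 ->
    `|x + t *: (s *: ei) + u *: (s *: ej) - x| <= `|s| *+ 2.
  move=> t1 u1; rewrite -(addrA x) (addrC x) addrK mulr2n.
  apply: le_trans (ler_normD _ _) _; rewrite !scalerA; apply: lerD.
    by apply: le_trans (norm_Zdelta_le _ _) _; rewrite normrM ler_piMl.
  by apply: le_trans (norm_Zdelta_le _ _) _; rewrite normrM ler_piMl.
have n01 (t : R) : 0 <= t <= 1 -> `|t| <= 1 by move=> /andP[t0 ?]; rewrite ger0_norm.
have [_ /(_ i)[dfi [_ /(_ j)[dfij _]]]] := Cf.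
pose g y := f (y + s *: ej) - f y.
have dg t : 0 <= t <= 1 -> is_derive (x + t *: (s *: ei)) (s *: ei) g
    (s *: (partial_d i f (x + t *: (s *: ei) + s *: ej) - partial_d i f (x + t *: (s *: ei)))).
  move=> /n01 t1; set y := x + _.
  have Uy1 : U (y + s *: ej) by apply: Us; rewrite -(scale1r (s *: ej)) bound // normr1.
  have Uy : U y by apply: Us; rewrite -(addr0 y) -(scale0r (s *: ej)) bound // normr0.
  rewrite scalerBr; apply: is_deriveB; last exact: is_deriveZ_dir (dfi _ Uy).
  have [d1 D1] := is_deriveZ_dir s (dfi _ Uy1).
  have eqf : (fun h : R => h^-1 *: (((fun y => f (y + s *: ej)) \o shift y) (h *: (s *: ei))
                               - f (y + s *: ej))) =
     (fun h : R => h^-1 *: ((f \o shift (y + s *: ej)) (h *: (s *: ei)) - f (y + s *: ej))).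
    by apply/funext => h /=; congr (_ *: (f _ - _)); exact/esym/addrA.
  by split; rewrite /derivable /derive eqf.
have [|t t01 gt] := @line_MVT R _ g x (s *: ei); first by move=> t /dg[].
have dj (u : R) : 0 <= u <= 1 ->
    is_derive (x + t *: (s *: ei) + u *: (s *: ej)) (s *: ej) (partial_d i f)
      (s *: partial_d j (partial_d i f) (x + t *: (s *: ei) + u *: (s *: ej))).
  by move=> u01; apply/is_deriveZ_dir/dfij/Us/bound; exact: n01.
have [|u u01 fu] := @line_MVT R _ (partial_d i f) (x + t *: (s *: ei)) (s *: ej).
  by move=> u /dj[].
exists (x + t *: (s *: ei) + u *: (s *: ej)); first by apply: bound; exact: n01.
rewrite -[LHS]/(g (x + s *: ei) - g x) gt; have [_ ->] := dg t t01.
by rewrite fu; have [_ ->] := dj u u01.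
Qed.

(** The second difference is symmetric in [i] and [j], so the two mixed derivatives agree at two
    points close to [x]; their continuity at [x] does the rest. *)
Lemma partial_d_comm (U : set E) (f : E -> R) x i j : open U -> U x -> Ck_on 2 U f ->
  partial_d i (partial_d j f) x = partial_d j (partial_d i f) x.
Proof.
move=> oU Ux Cf; apply/eqP; rewrite -subr_eq0 -normr_eq0 eq_le normr_ge0 andbT.
apply/ler_addgt0Pr => _/posnumP[e]; rewrite add0r.
have e20 : 0 < e%:num / 2 by rewrite divr_gt0.
have : \forall y \near x, U y /\
   (`|partial_d i (partial_d j f) x - partial_d i (partial_d j f) y| <= e%:num / 2 /\
    `|partial_d j (partial_d i f) x - partial_d j (partial_d i f) y| <= e%:num / 2).
  apply: filterI; first exact: (open_near oU Ux).
  apply: filterI.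
    have [_ /(_ j)[_ [_ /(_ i)[_ [c _]]]]] := Cf.
    by have /cvgrPdist_le := c x Ux; apply.
  have [_ /(_ i)[_ [_ /(_ j)[_ [c _]]]]] := Cf.
  by have /cvgrPdist_le := c x Ux; apply.
move=> /nbhs_normP[d /= d0 dP].
(* With this choice [2|s| = d / 2 < d], so both intermediate points fall in the ball of radius
   [d]. *)
pose s := d / 2 / 2.
have s0 : 0 < s by rewrite !divr_gt0.
have near_x y : `|y - x| <= `|s| *+ 2 -> U y /\
   (`|partial_d i (partial_d j f) x - partial_d i (partial_d j f) y| <= e%:num / 2 /\
    `|partial_d j (partial_d i f) x - partial_d j (partial_d i f) y| <= e%:num / 2).
  move=> yx; apply: dP; rewrite /= distrC (le_lt_trans yx) //.
  by rewrite gtr0_norm // mulr2n -splitr gtr_pMr // invf_lt1 // ltr1n.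
have Us y : `|y - x| <= `|s| *+ 2 -> U y by move=> /near_x[].
have [y /near_x[_ [_ yj]] Dy] := second_increment i j Cf Us.
have [z /near_x[_ [zi _]] Dz] := second_increment j i Cf Us.
have swap (a b c d' : R) : a - b - (c - d') = a - c - (b - d').
  by rewrite !opprB addrACA [- b - c]addrC addrACA.
have ss : x + s *: delta_mx 0 j + s *: delta_mx 0 i = x + s *: delta_mx 0 i + s *: delta_mx 0 j.
  exact: addrAC.
rewrite ss swap Dy in Dz.
rewrite (splitr e%:num).
exact: dist_le_via yj zi (mulfI (lt0r_neq0 s0) (mulfI (lt0r_neq0 s0) Dz)).
Qed.

End C1.

(** * Matrix-valued functions: Leibniz rule, Jacobian, chain rule *)

Section MatrixDerivatives.
Context {R : realType} {V : normedModType R}.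

Lemma derive_coord p q (f : V -> 'M[R]_(p, q)) x v i j : derivable f x v ->
  ('D_v f x) i j = 'D_v (fun y => f y i j) x.
Proof. by move=> df; rewrite derive_mx // mxE. Qed.

Lemma is_derive_mulmx p q r (f : V -> 'M[R]_(p, q)) (g : V -> 'M[R]_(q, r)) x v :
  derivable f x v -> derivable g x v ->
  is_derive x v (fun y => f y *m g y) ('D_v f x *m g x + f x *m 'D_v g x).
Proof.
move=> df dg.
have dfij i j := (derivable_mxP f x v).1 df i j.
have dgij i j := (derivable_mxP g x v).1 dg i j.
have D i j : is_derive x v (fun y => (f y *m g y) i j)
    (\sum_k (f x i k * 'D_v (fun y => g y k j) x + g x k j * 'D_v (fun y => f y i k) x)).
  rewrite (_ : (fun y => _) = \sum_k ((fun y => f y i k) * (fun y => g y k j))); last first.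
    by apply/funext => y; rewrite mxE fct_sumE.
  apply: is_derive_sum => k; split; first exact: derivableM.
  by rewrite deriveM.
have dfg : derivable (fun y => f y *m g y) x v.
  by apply/derivable_mxP => i j; have [] := D i j.
split => //; apply/matrixP => i j; rewrite derive_coord //; have [_ ->] := D i j.
rewrite !mxE -big_split; apply: eq_bigr => k _ /=.
rewrite !derive_coord // addrC; congr (_ + _); exact: mulrC.
Qed.

Lemma is_derive_trmx p q (f : V -> 'M[R]_(p, q)) x v : derivable f x v ->
  is_derive x v (fun y => (f y)^T) ('D_v f x)^T.
Proof.
move=> df; have dfij i j := (derivable_mxP f x v).1 df i j.
have eqf i j : (fun y => (f y)^T i j) = (fun y => f y j i).
  by apply/funext => y; rewrite mxE.
have dft : derivable (fun y => (f y)^T) x v.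
  by apply/derivable_mxP => i j; rewrite eqf.
split => //; apply/matrixP => i j.
by rewrite derive_coord // eqf mxE derive_coord.
Qed.

End MatrixDerivatives.

Section SmoothMatrices.
Context {R : realType} {n : nat}.
Local Notation E := 'rV[R]_n.
Implicit Types U : set E.

Lemma Ck_on_mxP p q k U (f : E -> 'M[R]_(p, q)) : open U ->
  Ck_on k U f <-> forall i j, Ck_on k U (fun x => f x i j).
Proof.
move=> oU; elim: k f => [|k IH] f.
  split=> [[cf _] i j|cf].
    split=> // x Ux; apply: (@continuous_comp _ _ _ f (fun M : 'M[R]_(p, q) => M i j)).
      exact: cf.
    exact: coord_continuous.
  by split=> // x Ux; apply: continuous_mx => i j; have [c _] := cf i j; exact: c.
split=> [[cf df] i j|cf].
  split=> [x Ux|l].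
    apply: (@continuous_comp _ _ _ f (fun M : 'M[R]_(p, q) => M i j)); first exact: cf.
    exact: coord_continuous.
  have [dl Cl] := df l; split=> [x Ux|]; first exact: (derivable_mxP _ _ _).1 (dl x Ux) i j.
  apply: Ck_on_ext ((IH _).1 Cl i j) => // x Ux.
  exact: derive_coord (dl x Ux).
have df l x : U x -> derivable f x (delta_mx 0 l).
  move=> Ux; apply/derivable_mxP => i j; have [_ /(_ l)[d _]] := cf i j; exact: d.
split=> [x Ux|l].
  by apply: continuous_mx => i j; have [c _] := cf i j; exact: c.
split=> [x Ux|]; first exact: df.
apply/IH => i j; have [_ /(_ l)[_ C]] := cf i j.
by apply: Ck_on_ext C => // x Ux; apply/esym/derive_coord/df.
Qed.

Lemma smooth_on_mxP p q U (f : E -> 'M[R]_(p, q)) : open U ->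
  smooth_on U f <-> forall i j, smooth_on U (fun x => f x i j).
Proof.
move=> oU; split=> [sf i j k|sf k]; first exact: (Ck_on_mxP _ _ oU).1 (sf k) i j.
by apply/Ck_on_mxP => // i j; exact: sf.
Qed.

Lemma smooth_on_mulmx p q r U (f : E -> 'M[R]_(p, q)) (g : E -> 'M[R]_(q, r)) :
  open U -> smooth_on U f -> smooth_on U g -> smooth_on U (fun x => f x *m g x).
Proof.
move=> oU /(smooth_on_mxP _ oU) sf /(smooth_on_mxP _ oU) sg.
apply/smooth_on_mxP => // i j.
apply: (@smooth_on_ext _ _ _ _ (fun x => \sum_k f x i k * g x k j)) => //.
  by move=> x _; rewrite mxE.
by apply: smooth_on_sum => // k _; exact: smooth_onM.
Qed.

Lemma smooth_on_trmx p q U (f : E -> 'M[R]_(p, q)) :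
  open U -> smooth_on U f -> smooth_on U (fun x => (f x)^T).
Proof.
move=> oU /(smooth_on_mxP _ oU) sf; apply/smooth_on_mxP => // i j.
by apply: smooth_on_ext (sf j i) => // x _; rewrite mxE.
Qed.

Lemma smooth_on_differentiable U (f : E -> R) x :
  open U -> smooth_on U f -> U x -> differentiable f x.
Proof.
move=> oU sf Ux; apply: (continuous_partials_differentiable oU Ux) => i.
  by move=> y; exact: smooth_on_derivable.
exact: smooth_on_continuous (smooth_on_partial i sf) Ux.
Qed.

Lemma smooth_on_differentiable_mx p q U (f : E -> 'M[R]_(p, q)) x :
  open U -> smooth_on U f -> U x -> differentiable f x.
Proof.
move=> oU /(smooth_on_mxP _ oU) sf Ux; apply: differentiable_mx => i j.
exact: smooth_on_differentiable (sf i j) Ux.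
Qed.

Lemma derive_partials (W : normedModType R) (f : E -> W) x (v : E) :
  differentiable f x -> 'D_v f x = \sum_i v 0 i *: partial_d i f x.
Proof.
move=> df; rewrite deriveE // {1}(row_sum_delta v) linear_sum.
by apply: eq_bigr => i _; rewrite linearZ /partial_d deriveE.
Qed.

Lemma jacobian_entry p (f : E -> 'rV[R]_p) x i j : differentiable f x ->
  ('J f x) i j = partial_d i (fun y => f y 0 j) x.
Proof.
move=> df; rewrite /jacobian mxE -deriveE //; apply: derive_coord.
exact: diff_derivable.
Qed.

(** ['J] is defined from the differential, so its entries are known to be partials only on [U],
    where [f] is differentiable. *)
Lemma smooth_on_jacobian p U (f : E -> 'rV[R]_p) :
  open U -> smooth_on U f -> smooth_on U (jacobian f).
Proof.
move=> oU sf; apply/smooth_on_mxP => // i j.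
have sfj := (smooth_on_mxP _ oU).1 sf 0 j.
apply: smooth_on_ext (smooth_on_partial i sfj) => // x Ux.
by rewrite jacobian_entry //; exact: smooth_on_differentiable_mx sf Ux.
Qed.

Lemma smooth_on_derive U (Y : E -> E) (f : E -> R) : open U ->
  smooth_on U Y -> smooth_on U f -> smooth_on U (fun x => 'D_(Y x) f x).
Proof.
move=> oU sY sf; apply: (@smooth_on_ext _ _ _ _ (fun x => \sum_i Y x 0 i * partial_d i f x)) => //.
  by move=> x Ux; rewrite derive_partials //; exact: smooth_on_differentiable sf Ux.
apply: smooth_on_sum => // i _; apply: smooth_onM => //; last exact: smooth_on_partial.
exact: (smooth_on_mxP _ oU).1 sY 0 i.
Qed.

Lemma smooth_on_derive_mx p q U (Y : E -> E) (f : E -> 'M[R]_(p, q)) : open U ->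
  smooth_on U Y -> smooth_on U f -> smooth_on U (fun x => 'D_(Y x) f x).
Proof.
move=> oU sY sf; apply/smooth_on_mxP => // i j.
have sfij := (smooth_on_mxP _ oU).1 sf i j.
apply: smooth_on_ext (smooth_on_derive oU sY sfij) => // x Ux.
by rewrite derive_coord //; exact/diff_derivable/(smooth_on_differentiable_mx oU sf).
Qed.

Lemma derive_comp m (f : E -> 'rV[R]_m) (W : normedModType R) (g : 'rV[R]_m -> W) x v :
  differentiable f x -> differentiable g (f x) ->
  'D_v (g \o f) x = 'D_(v *m ('J f x)) g (f x).
Proof.
move=> df dg; rewrite deriveE; last exact: differentiable_comp.
by rewrite diff_comp //= deriveE // -deriveEjacobian // deriveE.
Qed.

Lemma jacobian_comp m p (f : E -> 'rV[R]_m) (g : 'rV[R]_m -> 'rV[R]_p) x :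
  differentiable f x -> differentiable g (f x) ->
  'J (g \o f) x = ('J f x) *m ('J g (f x)).
Proof.
move=> df dg; have dgf : differentiable (g \o f) x by exact: differentiable_comp.
apply/row_matrixP => i; rewrite !rowE -deriveEjacobian // derive_comp //.
by rewrite deriveEjacobian // mulmxA.
Qed.

End SmoothMatrices.

(** * Cartan calculus in a chart *)

(** The k-th summand of d L(Y) a = L(Y) d a, at entry (i, j): [y], [K] are the k-th entries of Y and
    a, [u], [v] the i-th and j-th partials of [y], and [Z] its mixed partial, which cancels. *)
Lemma leibniz_exchange (R : comRingType) (y K Z u v P Q A B C D : R) :
  y * P + u * A + (K * Z + B * v) - (y * Q + v * C + (K * Z + D * u)) =
  y * (P - Q) + u * (A - D) + (B - C) * v.
Proof. by ring. Qed.

(** The k-th summand of d(i(Y) w) = L(Y) w, at entry (i, j). Closedness and antisymmetry give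
    [r = p - q], where [p], [q], [r] are the derivatives of [w] that enter. *)
Lemma cartan_exchange (R : comRingType) (y u v p p' q r wki wik wkj : R) :
  p' = - p -> p' + q + r = 0 -> wik = - wki ->
  y * p + u * wkj - (y * q + v * wki) = y * r + u * wkj + wik * v.
Proof.
move=> -> /eqP pqr ->; rewrite addrC addr_eq0 in pqr; rewrite (eqP pqr); ring.
Qed.

(** Algebra for [lie1_pullback]: [P] is the Jacobian of the map, [A] its derivative along Y, [B] and
    [C] the Jacobians of the two related fields. *)
Lemma mulmx_trmx_rearrange (R : comRingType) (m n : nat) (u : 'M[R]_(m, n))
    (A B C P : 'M[R]_n) : P *m C = B *m P + A ->
  u *m A^T + u *m P^T *m B^T = u *m C^T *m P^T.
Proof. by move=> PC; rewrite -!mulmxA -mulmxDr -!trmx_mul PC addrC [in RHS]linearD. Qed.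

Section EuclideanLie.
Context {R : realType} {n : nat}.
Local Notation E := 'rV[R]_n.
Implicit Types (U : set E) (X Y a : E -> E) (w : E -> 'M[R]_n).

(* The expressions of [lie_form1], [lie_form2] and [d_form1] in one chart. *)
Definition lie1 Y a : E -> E := fun x => 'D_(Y x) a x + a x *m (jacobian Y x)^T.

Definition lie2 Y w : E -> 'M[R]_n := fun x =>
  'D_(Y x) w x + jacobian Y x *m w x + w x *m (jacobian Y x)^T.

Definition d1 a : E -> 'M[R]_n := fun x =>
  \matrix_(i, j) (partial_d i a x 0 j - partial_d j a x 0 i).

Lemma smooth_on_lie1 U Y a : open U -> smooth_on U Y -> smooth_on U a ->
  smooth_on U (lie1 Y a).
Proof.
move=> oU sY sa; apply: smooth_onD => //; first exact: smooth_on_derive_mx.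
by apply: smooth_on_mulmx => //; apply: smooth_on_trmx => //; exact: smooth_on_jacobian.
Qed.

Lemma smooth_on_iter_lie1 U Y a m : open U -> smooth_on U Y -> smooth_on U a ->
  smooth_on U (iter m (lie1 Y) a).
Proof. by move=> oU sY sa; elim: m => //= m; exact: smooth_on_lie1. Qed.

Lemma lie2_ext U Y w w' : open U -> (forall x, U x -> w x = w' x) ->
  forall x, U x -> lie2 Y w x = lie2 Y w' x.
Proof.
move=> oU ww x Ux; rewrite /lie2 (ww x Ux).
by rewrite (near_eq_derive (Y x) (open_near oU Ux ww)).
Qed.

Lemma partial_coord p (f : E -> 'rV[R]_p) x i j : differentiable f x ->
  partial_d i f x 0 j = partial_d i (fun y => f y 0 j) x.
Proof. by move=> df; apply: derive_coord; exact: diff_derivable. Qed.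

Lemma derive_coord_partials p q (f : E -> 'M[R]_(p, q)) x (v : E) i j :
  differentiable f x ->
  ('D_v f x) i j = \sum_k v 0 k * partial_d k (fun y => f y i j) x.
Proof.
move=> df; rewrite derive_partials // summxE; apply: eq_bigr => k _.
by rewrite mxE derive_coord //; exact: diff_derivable.
Qed.

Lemma d1_entry U a x i j : open U -> smooth_on U a -> U x ->
  d1 a x i j = partial_d i (fun y => a y 0 j) x - partial_d j (fun y => a y 0 i) x.
Proof.
move=> oU sa Ux; have da := smooth_on_differentiable_mx oU sa Ux.
by rewrite mxE; congr (_ - _); exact: partial_coord da.
Qed.

Lemma is_derive_sumM (V : normedModType R) (f g : 'I_n -> V -> R) (f' g' : 'I_n -> R) x v :
  (forall k, is_derive x v (f k) (f' k)) -> (forall k, is_derive x v (g k) (g' k)) ->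
  is_derive x v (fun y => \sum_k f k y * g k y) (\sum_k (f k x * g' k + f' k * g k x)).
Proof.
move=> df dg; rewrite (_ : (fun y => _) = \sum_k (f k * g k)); last first.
  by apply/funext => y; rewrite fct_sumE.
apply: is_derive_sum => k; have [dfk <-] := df k; have [dgk <-] := dg k.
split; first exact: derivableM.
by rewrite deriveM //; congr (_ + _); exact: mulrC.
Qed.

Lemma derive_sumM (V : normedModType R) (f g : 'I_n -> V -> R) x v :
  (forall k, derivable (f k) x v) -> (forall k, derivable (g k) x v) ->
  'D_v (fun y => \sum_k f k y * g k y) x =
  \sum_k (f k x * 'D_v (g k) x + 'D_v (f k) x * g k x).
Proof.
move=> df dg.
by have [_ ->] := is_derive_sumM (fun k => derivableP (df k)) (fun k => derivableP (dg k)).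
Qed.

Lemma lie1_entry U Y a x j : open U -> smooth_on U Y -> smooth_on U a -> U x ->
  lie1 Y a x 0 j = \sum_k Y x 0 k * partial_d k (fun y => a y 0 j) x
                 + \sum_k a x 0 k * partial_d j (fun y => Y y 0 k) x.
Proof.
move=> oU sY sa Ux; rewrite /lie1 mxE derive_coord_partials; last first.
  exact: smooth_on_differentiable_mx sa Ux.
congr (_ + _); rewrite mxE; apply: eq_bigr => k _; rewrite [_^T _ _]mxE.
by rewrite jacobian_entry //; exact: smooth_on_differentiable_mx sY Ux.
Qed.

Lemma lie2_entry Y w x i j : differentiable Y x -> differentiable w x ->
  lie2 Y w x i j = \sum_k Y x 0 k * partial_d k (fun y => w y i j) x
    + \sum_k partial_d i (fun y => Y y 0 k) x * w x k j
    + \sum_k w x i k * partial_d j (fun y => Y y 0 k) x.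
Proof.
move=> dY dw; rewrite /lie2 mxE [X in X + _]mxE.
rewrite (derive_coord_partials (Y x) i j dw); congr (_ + _ + _).
  by rewrite mxE; apply: eq_bigr => k _; congr (_ * _); exact: jacobian_entry.
rewrite mxE; apply: eq_bigr => k _; congr (_ * _); rewrite mxE.
exact: jacobian_entry.
Qed.

Lemma partial_lie1 U Y a x i j : open U -> smooth_on U Y -> smooth_on U a -> U x ->
  partial_d i (fun y => lie1 Y a y 0 j) x =
  \sum_k (Y x 0 k * partial_d i (partial_d k (fun y => a y 0 j)) x
          + partial_d i (fun y => Y y 0 k) x * partial_d k (fun y => a y 0 j) x)
  + \sum_k (a x 0 k * partial_d i (partial_d j (fun y => Y y 0 k)) x
          + partial_d i (fun y => a y 0 k) x * partial_d j (fun y => Y y 0 k) x).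
Proof.
move=> oU sY sa Ux.
have sYk k := (smooth_on_mxP _ oU).1 sY 0 k.
have sak k := (smooth_on_mxP _ oU).1 sa 0 k.
have dY k := smooth_on_derivable (i:=i) (sYk k) Ux.
have da k := smooth_on_derivable (i:=i) (sak k) Ux.
have dpY k := smooth_on_derivable (i:=i) (smooth_on_partial j (sYk k)) Ux.
have dpa k := smooth_on_derivable (i:=i) (smooth_on_partial k (sak j)) Ux.
pose s1 y := \sum_k Y y 0 k * partial_d k (fun z => a z 0 j) y.
pose s2 y := \sum_k a y 0 k * partial_d j (fun z => Y z 0 k) y.
have ds1 : derivable s1 x (delta_mx 0 i).
  rewrite (_ : s1 = \sum_k ((fun y => Y y 0 k) * partial_d k (fun z => a z 0 j))).
    by apply: derivable_sum => k; exact: derivableM (dY k) (dpa k).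
  by apply/funext => y; rewrite fct_sumE.
have ds2 : derivable s2 x (delta_mx 0 i).
  rewrite (_ : s2 = \sum_k ((fun y => a y 0 k) * partial_d j (fun z => Y z 0 k))).
    by apply: derivable_sum => k; exact: derivableM (da k) (dpY k).
  by apply/funext => y; rewrite fct_sumE.
(* The coordinate formula for [lie1] holds on [U] only, which suffices for the derivative at [x]. *)
transitivity ('D_(delta_mx 0 i) (s1 + s2) x).
  apply: near_eq_derive; apply: (open_near oU Ux) => y Uy.
  exact: lie1_entry sY sa Uy.
rewrite (deriveD ds1 ds2); congr (_ + _).
  exact: (@derive_sumM _ (fun k y => Y y 0 k) (fun k => partial_d k (fun z => a z 0 j)) x _ dY dpa).
exact: (@derive_sumM _ (fun k y => a y 0 k) (fun k => partial_d j (fun z => Y z 0 k)) x _ da dpY).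
Qed.

Lemma smooth_on_d1 U a : open U -> smooth_on U a -> smooth_on U (d1 a).
Proof.
move=> oU sa; apply/smooth_on_mxP => // i j.
have sak k := (smooth_on_mxP _ oU).1 sa 0 k.
apply: (@smooth_on_ext _ _ _ _ (fun x => partial_d i (fun y => a y 0 j) x
    + cst (-1) x * partial_d j (fun y => a y 0 i) x)) => //.
  by move=> x Ux; rewrite (d1_entry _ _ oU sa Ux) mulN1r.
apply: smooth_onD => //; first exact: smooth_on_partial.
by apply: smooth_onM => //; [exact: smooth_on_cst|exact: smooth_on_partial].
Qed.

(** Summand by summand in the contracted index: the second derivatives of [a] are reordered so that
    the one along Y comes last, and those of [Y] are symmetric in [i] and [j], so they drop out of
    the antisymmetrization. *)
Lemma d1_lie1 U Y a x : open U -> smooth_on U Y -> smooth_on U a -> U x ->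
  d1 (lie1 Y a) x = lie2 Y (d1 a) x.
Proof.
move=> oU sY sa Ux; apply/matrixP => i j.
have sYk k := (smooth_on_mxP _ oU).1 sY 0 k.
have sak k := (smooth_on_mxP _ oU).1 sa 0 k.
have dY := smooth_on_differentiable_mx oU sY Ux.
rewrite (d1_entry _ _ oU (smooth_on_lie1 oU sY sa) Ux) !(partial_lie1 _ _ oU sY sa Ux).
have dda := smooth_on_differentiable_mx oU (smooth_on_d1 oU sa) Ux.
rewrite (lie2_entry i j dY dda).
have eqd k : partial_d k (fun y => d1 a y i j) x =
    partial_d k (partial_d i (fun y => a y 0 j)) x
    - partial_d k (partial_d j (fun y => a y 0 i)) x.
  rewrite -[RHS]deriveB; first last.
  - exact: smooth_on_derivable (smooth_on_partial _ (sak i)) Ux.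
  - exact: smooth_on_derivable (smooth_on_partial _ (sak j)) Ux.
  apply: near_eq_derive; apply: (open_near oU Ux) => y Uy.
  by rewrite (d1_entry _ _ oU sa Uy).
rewrite -!big_split -sumrB; apply: eq_bigr => k _ /=.
rewrite (partial_d_comm i k oU Ux (sak j 2)) (partial_d_comm j k oU Ux (sak i 2)).
rewrite (partial_d_comm i j oU Ux (sYk k 2)).
apply: etrans (leibniz_exchange _ _ _ _ _ _ _ _ _ _ _) _.
congr (_ * _ + _ * _ + _ * _); first exact/esym/eqd.
  exact/esym/(d1_entry _ _ oU sa Ux).
exact/esym/(d1_entry _ _ oU sa Ux).
Qed.

Lemma d1_interior U Y w x : open U -> smooth_on U Y -> smooth_on U w -> U x ->
  (forall y, U y -> (w y)^T = - w y) ->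
  (forall i j k, partial_d i w x j k + partial_d j w x k i + partial_d k w x i j = 0) ->
  d1 (fun y => Y y *m w y) x = lie2 Y w x.
Proof.
move=> oU sY sw Ux wT dw; apply/matrixP => i j.
have sYk k := (smooth_on_mxP _ oU).1 sY 0 k.
have swk k l := (smooth_on_mxP _ oU).1 sw k l.
have dY := smooth_on_differentiable_mx oU sY Ux.
have ddw := smooth_on_differentiable_mx oU sw Ux.
have wC k l y : U y -> w y k l = - w y l k.
  by move=> /wT /matrixP /(_ l k); rewrite !mxE.
have pw k l m : partial_d k w x l m = partial_d k (fun y => w y l m) x.
  by apply: derive_coord; exact: diff_derivable.
have pwC k l m : partial_d k w x l m = - partial_d k w x m l.
  rewrite !pw -[RHS]deriveN; last exact: smooth_on_derivable (swk _ _) Ux.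
  by apply: near_eq_derive; apply: (open_near oU Ux) => y Uy; exact: wC.
have pi k l : partial_d k (fun y => (Y y *m w y) 0 l) x =
    \sum_m (Y x 0 m * partial_d k w x m l + partial_d k (fun y => Y y 0 m) x * w x m l).
  have -> : (fun y => (Y y *m w y) 0 l) = (fun y => \sum_m Y y 0 m * w y m l).
    by apply/funext => y; rewrite mxE.
  rewrite /partial_d (@derive_sumM _ (fun m y => Y y 0 m) (fun m y => w y m l)).
  - by apply: eq_bigr => m _; congr (_ * _ + _); exact/esym/pw.
  - by move=> m; exact: smooth_on_derivable (sYk _) Ux.
  - by move=> m; exact: smooth_on_derivable (swk _ _) Ux.
rewrite (d1_entry _ _ oU (smooth_on_mulmx oU sY sw) Ux) !pi.
rewrite (lie2_entry i j dY ddw) -!big_split -sumrB.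
apply: eq_bigr => k _ /=.
apply: etrans (cartan_exchange _ _ _ _ (pwC i j k) (dw i j k) (wC i k x Ux)) _.
by congr (_ * _ + _ + _); exact: pw.
Qed.

(** Cartan's formula is the base case and accounts for the extra Lie derivative on the right. *)
Lemma d1_iter_lie1 U Y w x m : open U -> smooth_on U Y -> smooth_on U w ->
  (forall y, U y -> (w y)^T = - w y) ->
  (forall y, U y -> forall i j k,
     partial_d i w y j k + partial_d j w y k i + partial_d k w y i j = 0) -> U x ->
  d1 (iter m (lie1 Y) (fun y => Y y *m w y)) x = iter m.+1 (lie2 Y) w x.
Proof.
move=> oU sY sw wT dw; have si := smooth_on_mulmx oU sY sw.
elim: m x => [|m IH] x Ux; first exact: d1_interior sY sw Ux wT (dw x Ux).
rewrite iterS (d1_lie1 oU sY _ Ux); last exact: smooth_on_iter_lie1.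
exact: (@lie2_ext U Y _ _ oU IH x Ux).
Qed.

(** Leibniz rule for the pairing; the Jacobian term of [lie1] cancels against the derivative of [Y]
    along [X] in the bracket. *)
Lemma derive_pairing U Y X a x : open U -> smooth_on U Y -> smooth_on U X ->
  smooth_on U a -> U x ->
  'D_(Y x) (fun y => X y *m (a y)^T) x =
  X x *m (lie1 Y a x)^T + ('D_(Y x) X x - 'D_(X x) Y x) *m (a x)^T.
Proof.
move=> oU sY sX sa Ux.
have dY := smooth_on_differentiable_mx oU sY Ux.
have dX := diff_derivable (v:=Y x) (smooth_on_differentiable_mx oU sX Ux).
have da := diff_derivable (v:=Y x) (smooth_on_differentiable_mx oU sa Ux).
have [dat Dat] := is_derive_trmx da.
have [_ ->] := is_derive_mulmx dX dat.
rewrite Dat /lie1 linearD /= trmx_mul trmxK mulmxDr mulmxBl.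
rewrite (deriveEjacobian (X x) dY) mulmxA.
by rewrite addrC -[RHS]addrA; congr (_ + _); rewrite addrC subrK.
Qed.

(** The derivative of the relation between [Y] and [Y']. It produces second partials of [phi]
    contracted with [Y] in one index; by symmetry they form the derivative of the Jacobian along
    [Y]. *)
Lemma jacobian_pushforward U V (phi Y Y' : E -> E) x : open U -> open V ->
  (forall y, U y -> V (phi y)) ->
  smooth_on U phi -> smooth_on U Y -> smooth_on V Y' ->
  (forall y, U y -> Y' (phi y) = Y y *m jacobian phi y) -> U x ->
  jacobian phi x *m jacobian Y' (phi x) =
    jacobian Y x *m jacobian phi x + 'D_(Y x) (jacobian phi) x.
Proof.
move=> oU oV UV sphi sY sY' YY' Ux.
have dphiU y (Uy : U y) := smooth_on_differentiable_mx oU sphi Uy.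
have dY := smooth_on_differentiable_mx oU sY Ux.
have sJ := smooth_on_jacobian oU sphi.
have dJ := smooth_on_differentiable_mx oU sJ Ux.
have dY' := smooth_on_differentiable_mx oV sY' (UV x Ux).
have sphij j := (smooth_on_mxP _ oU).1 sphi 0 j.
have dYphi : differentiable (Y' \o phi) x := differentiable_comp (dphiU x Ux) dY'.
apply: etrans (esym (jacobian_comp (dphiU x Ux) dY')) _.
apply/matrixP => i j; rewrite (jacobian_entry i j dYphi) mxE [X in _ = X + _]mxE.
rewrite (derive_coord_partials (Y x) i j dJ).
transitivity (partial_d i (fun y => \sum_k Y y 0 k * jacobian phi y k j) x).
  apply: near_eq_derive; apply: (open_near oU Ux) => y Uy /=.
  by rewrite (YY' y Uy) mxE.
have dYk k : derivable (fun y => Y y 0 k) x (delta_mx 0 i).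
  exact: smooth_on_derivable ((smooth_on_mxP _ oU).1 sY 0 k) Ux.
have dJk k : derivable (fun y => jacobian phi y k j) x (delta_mx 0 i).
  exact: smooth_on_derivable ((smooth_on_mxP _ oU).1 sJ k j) Ux.
apply: etrans (derive_sumM dYk dJk) _.
rewrite -big_split; apply: eq_bigr => k _ /=; rewrite addrC; congr (_ * _ + _ * _).
  transitivity (partial_d i (partial_d k (fun y => phi y 0 j)) x).
    apply: near_eq_derive; apply: (open_near oU Ux) => y Uy.
    exact: jacobian_entry (dphiU y Uy).
  rewrite (partial_d_comm i k oU Ux (sphij j 2)).
  apply: near_eq_derive; apply: (open_near oU Ux) => y Uy.
  exact/esym/(jacobian_entry _ _ (dphiU y Uy)).
exact: (esym (jacobian_entry i k dY)).
Qed.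

(** Naturality of the Lie derivative for [phi]-related fields; it is applied with [phi] a transition
    map. *)
Lemma lie1_pullback U V (phi Y Y' a a' : E -> E) x : open U -> open V ->
  (forall y, U y -> V (phi y)) ->
  smooth_on U phi -> smooth_on U Y -> smooth_on V Y' -> smooth_on V a' ->
  (forall y, U y -> Y' (phi y) = Y y *m jacobian phi y) ->
  (forall y, U y -> a y = a' (phi y) *m (jacobian phi y)^T) -> U x ->
  lie1 Y a x = lie1 Y' a' (phi x) *m (jacobian phi x)^T.
Proof.
move=> oU oV UV sphi sY sY' sa' YY' aa' Ux.
have dphi := smooth_on_differentiable_mx oU sphi Ux.
have dJ := smooth_on_differentiable_mx oU (smooth_on_jacobian oU sphi) Ux.
have da' := smooth_on_differentiable_mx oV sa' (UV x Ux).
have JJ := jacobian_pushforward oU oV UV sphi sY sY' YY' Ux.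
have daphi : differentiable (a' \o phi) x := differentiable_comp dphi da'.
have [dJt DJt] := is_derive_trmx (diff_derivable (v:=Y x) dJ).
have [_ Da] := is_derive_mulmx (diff_derivable (v:=Y x) daphi) dJt.
have DYa : 'D_(Y x) a x = 'D_(Y x) (fun y => (a' \o phi) y *m (jacobian phi y)^T) x.
  by apply: near_eq_derive; exact: (open_near oU Ux).
rewrite /lie1 DYa Da DJt (aa' x Ux) (derive_comp (Y x) dphi da') -(YY' x Ux).
rewrite mulmxDl -addrA; congr (_ + _).
exact: mulmx_trmx_rearrange JJ.
Qed.

End EuclideanLie.

(** * The Poincaré lemma on a ball *)

(** Differentiation under the integral, dominated by the constant [C], followed by the fundamental
    theorem of calculus, since the derivative of the integrand at [s = 0] has the primitive [G] in
    [t]. *)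
Lemma is_derive_parameter_integral (R : realType) (f d : R -> R -> R) (G : R -> R) (r C : R) :
  0 < r ->
  (forall s : R, `|s| < r -> {within `[0, 1], continuous (f s)}) ->
  (forall s t : R, `|s| < r -> 0 <= t <= 1 ->
     is_derive s (1 : R) (fun s' : R => f s' t) (d s t)) ->
  (forall s t : R, `|s| < r -> 0 <= t <= 1 -> `|d s t| <= C) ->
  {within `[0, 1], continuous (d 0)} ->
  (forall t : R, 0 <= t <= 1 -> is_derive t (1 : R) G (d 0 t)) ->
  is_derive (0 : R) (1 : R) (fun s => \int[lebesgue_measure]_(t in `[0, 1]) f s t) (G 1 - G 0).
Proof.
move=> r0 cf df dC cd dG.
pose mu := @lebesgue_measure R.
have I0 : `]-r, r[%classic (0 : R) by rewrite /= in_itv /= oppr_lt0 r0.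
have Ir (s : R) : `]-r, r[%classic s -> `|s| < r by rewrite /= in_itv /= ltr_norml.
have C0 : 0 <= C.
  by apply: le_trans (normr_ge0 (d 0 0)) (dC _ _ _ _); rewrite ?normr0 // lexx ler01.
have I01 (t : R) : `[0, 1]%classic t -> 0 <= t <= 1 by rewrite /= in_itv.
have mI : measurable (`[0, 1]%classic : set (measurableTypeR R)) by exact: measurable_itv.
have intf s : `]-r, r[%classic s -> mu.-integrable `[0, 1] (EFin \o f s).
  move=> /Ir sr; apply: continuous_compact_integrable; first exact: segment_compact.
  exact: cf.
have derf s t : `]-r, r[%classic s -> `[0, 1]%classic t -> derivable (f ^~ t) s 1.
  by move=> /Ir sr /I01 t01; have [] := df s t sr t01.
have intC : mu.-integrable `[0, 1] (EFin \o cst C).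
  apply: continuous_compact_integrable; first exact: segment_compact.
  by apply: continuous_subspaceT => ?; exact: cvg_cst.
have ubC s t : `]-r, r[%classic s -> `[0, 1]%classic t -> `|partial1of2 f s t| <= cst C t.
  move=> /Ir sr /I01 t01; rewrite partial1of2E; have [_ ->] := df s t sr t01.
  exact: dC.
split; first exact: (derivable_under_integral mI I0 intf derf (fun=> C0) intC ubC).
rewrite -derive1E (differentiation_under_integral mI I0 intf derf (fun=> C0) intC ubC).
rewrite (@eq_Rintegral _ _ _ mu `[0, 1]%classic (d 0)); last first.
  move=> t; rewrite inE => /I01 t01; rewrite partial1of2E.
  by have [|_ ->] := df 0 t _ t01; first by rewrite normr0.
have cG t : 0 <= t <= 1 -> {for t, continuous G}.
  by move=> /dG[dGt _]; apply: differentiable_continuous; exact/derivable1_diffP.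
rewrite /Rintegral (@continuous_FTC2 _ (d 0) G 0 1 ltr01 cd) //.
  split.
  - move=> t; rewrite in_itv /= => /andP[t0 t1].
    by have [] := dG t; rewrite // !ltW.
  - by apply: cvg_at_right_filter; apply: cG; rewrite lexx ler01.
  - by apply: cvg_at_left_filter; apply: cG; rewrite lexx ler01.
move=> t; rewrite in_itv /= => /andP[t0 t1]; rewrite derive1E.
by have [|_ ->] := dG t; rewrite // !ltW.
Qed.

Section Poincare.
Context {R : realType} {n : nat}.
Local Notation E := 'rV[R]_n.

(** Supplies the dominating constants for the parameter integral. *)
Lemma bounded_on_closed_ball (f : E -> R) (x0 : E) (rho : R) : 0 < rho ->
  (forall y, `|y - x0| <= rho -> {for y, continuous f}) ->
  exists C, forall y, `|y - x0| <= rho -> `|f y| <= C.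
Proof.
move=> rho0 cf; pose A : set E := closed_ball x0 rho.
have AE y : A y = (`|y - x0| <= rho) :> Prop.
  by rewrite /A closed_ballE // /closed_ball_ /= distrC.
have A0 : A !=set0 by exists x0; rewrite AE subrr normr0 ltW.
have cA : compact A.
  apply: bounded_closed_compact; last exact: closed_ball_closed.
  exists (rho + `|x0|); split; first exact: num_real.
  move=> N ltN y; rewrite AE => yx0; apply: le_trans (ltW ltN).
  by rewrite -[y](subrK x0) (le_trans (ler_normD _ _)) // lerD2r.
have cnf : {within A, continuous (fun y => `|f y|)}.
  apply: continuous_in_subspaceT => y; rewrite inE AE => /cf cfy.
  exact: (@continuous_comp _ _ _ f Num.norm y cfy (@norm_continuous _ _ _)).
have [c _ fc] := EVT_max_rV A0 cA cnf.
by exists (`|f c|) => y Ay; apply: fc; rewrite inE AE.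
Qed.

Lemma smooth_of_gradient U (F : E -> R) (g : 'I_n -> E -> R) : open U ->
  (forall i x, U x -> is_derive x (delta_mx 0 i) F (g i x)) ->
  (forall i, smooth_on U (g i)) -> smooth_on U F.
Proof.
move=> oU dF sg.
have sp i : smooth_on U (partial_d i F).
  by apply: (smooth_on_ext oU _ (sg i)) => x Ux; have [_ <-] := dF i x Ux.
have dFi i x : U x -> derivable F x (delta_mx 0 i) by move=> /(dF i)[].
apply: smooth_onP => // x Ux; apply: differentiable_continuous.
apply: (continuous_partials_differentiable oU Ux dFi) => i.
exact: smooth_on_continuous (sp i) Ux.
Qed.

Lemma ball_segment (x0 : E) (r : R) x (t : R) : ball x0 r x -> 0 <= t <= 1 ->
  ball x0 r (x0 + t *: (x - x0)).
Proof.
rewrite -ball_normE /= => xr /andP[t0 t1].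
rewrite opprD addrA subrr sub0r normrN normrZ ger0_norm //.
by rewrite distrC (le_lt_trans _ xr) // distrC ler_piMl.
Qed.

(** Mean value theorem for [g - f] on the segment from the centre, which stays in the ball. *)
Lemma gradient_eq_cst (x0 : E) (r : R) (f g : E -> R) :
  smooth_on (ball x0 r) f -> smooth_on (ball x0 r) g ->
  (forall x i, ball x0 r x -> partial_d i f x = partial_d i g x) ->
  forall x, ball x0 r x -> g x - f x = g x0 - f x0.
Proof.
move=> sf sg fg x Bx; have oB : open (ball x0 r) by exact: ball_open.
have D y v : ball x0 r y -> is_derive y v (g - f) 0.
  move=> By; have df := smooth_on_differentiable oB sf By.
  have dg := smooth_on_differentiable oB sg By.
  have dfv := diff_derivable (v:=v) df; have dgv := diff_derivable (v:=v) dg.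
  split; first exact: derivableB dgv dfv.
  rewrite (deriveB dgv dfv) (derive_partials v df) (derive_partials v dg).
  by rewrite -sumrB big1 // => i _; rewrite (fg y i By) subrr.
have [|t t01] := @line_MVT R _ (g - f) x0 (x - x0).
  by move=> t t01; have [] := D _ (x - x0) (ball_segment Bx t01).
have [_ ->] := D _ (x - x0) (ball_segment Bx t01).
by rewrite (addrC x0) subrK => /eqP; rewrite subr_eq0 => /eqP.
Qed.

(** The i-th partial of the radial integrand is a_i plus [t] times the sum of (x - x0)_k d_i a_k,
    taken at x0 + t(x - x0). Closedness replaces d_i a_k by d_k a_i, and the result is the
    t-derivative of t a_i(x0 + t(x - x0)), whose increment over [0, 1] is a_i(x). *)
Lemma poincare_ball (x0 : E) (r : R) (a : E -> E) :
  smooth_on (ball x0 r) a -> (forall x, ball x0 r x -> d1 a x = 0) ->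
  exists2 F : E -> R, smooth_on (ball x0 r) F &
    forall x i, ball x0 r x -> is_derive x (delta_mx 0 i) F (a x 0 i).
Proof.
move=> sa da0; have oB : open (ball x0 r) by exact: ball_open.
have sak k : smooth_on (ball x0 r) (fun x => a x 0 k) := (smooth_on_mxP _ oB).1 sa 0 k.
have closed i k x : ball x0 r x ->
    partial_d i (fun y => a y 0 k) x = partial_d k (fun y => a y 0 i) x.
  move=> Bx; apply/eqP; rewrite -subr_eq0 -(d1_entry i k oB sa Bx) da0 //.
  by rewrite mxE.
pose F x := \int[lebesgue_measure]_(t in `[0, 1])
  \sum_k (x - x0) 0 k * a (x0 + t *: (x - x0)) 0 k.
suff dF x i : ball x0 r x -> is_derive x (delta_mx 0 i) F (a x 0 i).
  by exists F => //; exact: (smooth_of_gradient oB (fun i x => dF x i) sak).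
move=> Bx; set ei : E := delta_mx 0 i.
have xr : `|x - x0| < r by move: Bx; rewrite -ball_normE /= distrC.
(* [rho] lies strictly between [|x - x0|] and [r]: for shifts of size below [del], all segments to
   the centre stay in a compact ball inside the open one, where the integrand has uniform bounds. *)
pose rho := (`|x - x0| + r) / 2; pose del := rho - `|x - x0|.
have xrho : `|x - x0| < rho by rewrite /rho midf_lt.
have rhor : rho < r by rewrite /rho midf_lt.
have rho0 : 0 < rho by apply: le_lt_trans xrho.
have del0 : 0 < del by rewrite subr_gt0.
have Brho y : `|y - x0| <= rho -> ball x0 r y.
  by move=> yr; rewrite -ball_normE /= distrC (le_lt_trans yr).
(* Written so that the integral of [f s] is [F (s *: ei + x)] by computation, the form that
   [is_derive_of_line] expects. *)
pose w (s : R) : E := s *: ei + x - x0.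
have ws (s : R) : `|s| < del -> `|w s| <= rho.
  move=> sd; rewrite /w -addrA; apply: le_trans (ler_normD _ _) _.
  rewrite -lerBrDr; apply: le_trans (norm_Zdelta_le _ _) _; exact: ltW.
pose p (s t : R) : E := x0 + t *: w s.
have pr (s t : R) : `|s| < del -> 0 <= t <= 1 -> `|p s t - x0| <= rho.
  move=> sd /andP[t0 t1]; rewrite /p addrC addrA addNr add0r normrZ ger0_norm //.
  by apply: le_trans (ws s sd); rewrite ler_piMl.
pose f (s t : R) := \sum_k w s 0 k * a (p s t) 0 k.
pose d (s t : R) := a (p s t) 0 i + t * \sum_k w s 0 k * partial_d i (fun y => a y 0 k) (p s t).
pose G (t : R) := t * a (p 0 t) 0 i.
have dline (g : E -> R) (s t : R) : smooth_on (ball x0 r) g -> `|s| < del -> 0 <= t <= 1 ->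
    is_derive t (1 : R) (fun t' => g (p s t')) ('D_(w s) g (p s t)).
  move=> sg sd t01; apply: is_derive_line; apply: diff_derivable.
  exact: smooth_on_differentiable oB sg (Brho _ (pr s t sd t01)).
have del00 : `|0 : R| < del by rewrite normr0.
have spik k := smooth_on_partial i (sak k).
have cf (s : R) : `|s| < del -> {within `[0, 1], continuous (f s)}.
  move=> sd; apply: derivable_within_continuous => t; rewrite in_itv /= => t01.
  have [] // := is_derive_sumM (fun k => is_derive_cst (w s 0 k) t (1 : R))
                  (fun k => dline _ s t (sak k) sd t01).
have cd : {within `[0, 1], continuous (d 0)}.
  apply: derivable_within_continuous => t; rewrite in_itv /= => t01.
  have [ds _] := is_derive_sumM (fun k => is_derive_cst (w 0 0 k) t (1 : R))
                  (fun k => dline _ 0 t (spik k) del00 t01).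
  have [da _] := dline _ 0 t (sak i) del00 t01.
  have dm := derivableM (@derivable_id R R t 1) ds.
  exact: (derivableD da dm).
have dw (s : R) k : is_derive s (1 : R) (fun s' : R => w s' 0 k) (ei 0 k).
  have -> : (fun s' => w s' 0 k) = (fun s' => s' * ei 0 k) + cst ((x - x0) 0 k).
    by apply/funext => s'; rewrite fctE /w -addrA mxE [X in X + _]mxE.
  by apply: is_derive_eq; rewrite addr0 scaler0 add0r [_ *: _]mulr1.
have df (s t : R) : `|s| < del -> 0 <= t <= 1 ->
    is_derive s (1 : R) (fun s' : R => f s' t) (d s t).
  move=> sd t01.
  have pline s' : p s' t = x0 + t *: (x - x0) + s' *: (t *: ei).
    rewrite /p /w -addrA scalerDr -[RHS]addrA; congr (x0 + _).
    by rewrite (addrC (t *: (s' *: ei))) scalerA (mulrC t) -scalerA.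
  have dp k : is_derive s (1 : R) (fun s' => a (p s' t) 0 k)
      (t * partial_d i (fun y => a y 0 k) (p s t)).
    have -> : (fun s' => a (p s' t) 0 k) =
        (fun s' => a (x0 + t *: (x - x0) + s' *: (t *: ei)) 0 k).
      by apply/funext => s'; rewrite pline.
    have dk := smooth_on_derivable (i:=i) (sak k) (Brho _ (pr s t sd t01)).
    have [dt Dt] := is_deriveZ_dir t dk; rewrite pline in dt Dt *.
    by apply: is_derive_eq; [exact: is_derive_line dt|exact: Dt].
  apply: is_derive_eq; first exact: (is_derive_sumM (dw s) dp).
  rewrite big_split /= addrC /d mulr_sumr; congr (_ + _).
    rewrite (bigD1 i) //= big1 ?addr0; first by rewrite mxE !eqxx mul1r.
    by move=> k ki; rewrite mxE eqxx (negbTE ki) mul0r.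
  by apply: eq_bigr => k _; exact: mulrCA.
have dG (t : R) : 0 <= t <= 1 -> is_derive t (1 : R) G (d 0 t).
  move=> t01; apply: is_derive_eq.
    exact: (@is_deriveM _ _ (@id R) (fun t' => a (p 0 t') 0 i) t 1 _ _ (is_derive_id t 1)
      (dline _ 0 t (sak i) del00 t01)).
  have Bp := Brho _ (pr 0 t del00 t01).
  rewrite (derive_partials (w 0) (smooth_on_differentiable oB (sak i) Bp)).
  rewrite addrC /d; congr (_ + _); first exact: mulr1.
  congr (_ * _); apply: eq_bigr => k _; congr (_ * _); exact: closed.
have [Ca ha] : exists C, forall y, `|y - x0| <= rho -> `|a y 0 i| <= C.
  apply: (bounded_on_closed_ball rho0) => y /Brho; exact: smooth_on_continuous.
have hk k : exists C, forall y, `|y - x0| <= rho -> `|partial_d i (fun y => a y 0 k) y| <= C.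
  apply: (bounded_on_closed_ball rho0) => y /Brho; exact: smooth_on_continuous.
have [Ck hCk] := fin_all_exists hk.
(* The factor [t] is at most 1 and each entry of [w s] is at most [rho]. *)
have dC (s t : R) : `|s| < del -> 0 <= t <= 1 -> `|d s t| <= Ca + \sum_k rho * Ck k.
  move=> sd t01; have prst := pr s t sd t01.
  apply: le_trans (ler_normD _ _) _; apply: lerD; first exact: ha.
  rewrite normrM; have /andP[t0 t1] := t01; rewrite (ger0_norm t0).
  apply: (@le_trans _ _ `|\sum_k w s 0 k * partial_d i (fun y => a y 0 k) (p s t)|).
    by rewrite ler_piMl.
  apply: le_trans (ler_norm_sum _ _ _) _; apply: ler_sum => k _.
  rewrite normrM; apply: ler_pM => //; last exact: hCk.
  exact: le_trans (mx_norm_ge _ _ _) (ws s sd).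
have H := is_derive_parameter_integral del0 cf df dC cd dG.
have <- : G 1 - G 0 = a x 0 i.
  by rewrite /G /p /w !scale0r !scale1r add0r mul1r mul0r subr0 (addrC x0) subrK.
apply: is_derive_of_line; exact: H.
Qed.

End Poincare.

(** * Globalization over the atlas *)

Section Charts.
Context {R : realType} {n : nat} {T : topologicalType}.
Implicit Types c : chart R n T.

Lemma open_cod c : open (cod c).
Proof. exact: cod_open. Qed.
Arguments open_cod c : clear implicits.

(** Since [cod c] is open, continuity within it is continuity at each of its points. *)
Lemma open_coord_preimage c (O : set T) : open O ->
  open [set x | cod c x /\ O (of_coord c x)].
Proof.
move=> oO; rewrite openE => x [cx Ox]; rewrite /interior.
have cont : {for x, continuous (of_coord c)}.
  have := of_coord_continuous (c:=c); rewrite continuous_open_subspace; last exact: open_cod.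
  by apply; rewrite inE.
have cN : nbhs x (cod c) by exact: (open_near (open_cod c) cx).
have ON : nbhs x (of_coord c @^-1` O) by exact: (cont _ (open_nbhs_nbhs (conj oO Ox))).
exact: filterS (filterI cN ON).
Qed.

Lemma open_chart_preimage c (B : set 'rV[R]_n) : open B ->
  open [set p | dom c p /\ B (to_coord c p)].
Proof.
move=> oB; rewrite openE => p [cp Bp]; rewrite /interior.
have cont : {for p, continuous (to_coord c)}.
  have := to_coord_continuous (c:=c); rewrite continuous_open_subspace; last exact: dom_open.
  by apply; rewrite inE.
have cN : nbhs p (dom c) by exact: (open_near (dom_open c) cp).
have BN : nbhs p (to_coord c @^-1` B) by exact: (cont _ (open_nbhs_nbhs (conj oB Bp))).
exact: filterS (filterI cN BN).
Qed.

Lemma overlap_open c c' : open (overlap c c').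
Proof. exact: open_coord_preimage (dom_open c'). Qed.

Lemma transition_cod c c' x : overlap c c' x -> cod c' (transition c c' x).
Proof. by move=> [_ /to_coordP[]]. Qed.

End Charts.
Arguments open_cod {R n T} c.
Arguments open_coord_preimage {R n T} c {O} _.
Arguments overlap_open {R n T} c c'.

(** * Forms on the manifold, the pairing with the Hamiltonian field, local primitives *)

Section Manifold.
Context {R : realType} {n : nat} (M : manifold R n).
Local Notation ch := (atlas M).
Implicit Types (Y X alpha : components M 'rV[R]_n) (omega : components M 'M[R]_n).

(** The Lie derivative in chart [a] involves only the components in that chart, so iteration
    commutes with fixing the chart. *)
Lemma iter_lie_form1E Y alpha m a :
  iter m (lie_form1 Y) alpha a = iter m (lie1 (Y a)) (alpha a).
Proof. by elim: m => //= m IH; rewrite -IH. Qed.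

Lemma iter_lie_form2E Y omega m a :
  iter m (lie_form2 Y) omega a = iter m (lie2 (Y a)) (omega a).
Proof. by elim: m => //= m IH; rewrite -IH. Qed.

Lemma is_form1_interior Y omega :
  is_vector_field Y -> is_form2 omega -> is_form1 (interior_product Y omega).
Proof.
move=> [sY tY] [so _ to]; split=> [a|a b x ox].
  by apply: smooth_on_mulmx; [exact: open_cod|exact: sY|exact: so].
by rewrite /interior_product (to a b x ox) (tY a b x ox) !mulmxA.
Qed.

Lemma is_form1_lie Y alpha :
  is_vector_field Y -> is_form1 alpha -> is_form1 (lie_form1 Y alpha).
Proof.
move=> [sY tY] [sa ta]; split=> [a|a b x ox].
  by apply: smooth_on_lie1; [exact: open_cod|exact: sY|exact: sa].
have oU := overlap_open (ch a) (ch b).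
have sub : overlap (ch a) (ch b) `<=` cod (ch a) by move=> y [].
exact: (lie1_pullback oU (open_cod (ch b)) (@transition_cod _ _ _ (ch a) (ch b))
  (atlas_smooth a b) (smooth_on_sub sub (sY a)) (sY b) (sa b) (tY a b) (ta a b) ox).
Qed.

Lemma is_form1_iter_lie Y alpha m :
  is_vector_field Y -> is_form1 alpha -> is_form1 (iter m (lie_form1 Y) alpha).
Proof. by move=> vY fa; elim: m => //= m; exact: is_form1_lie. Qed.

Lemma closed_iter_lie_interior omega Y m :
  symplectic_form omega -> is_vector_field Y ->
  eq_on setT (iter m.+1 (lie_form2 Y) omega) (fun _ _ => 0) ->
  closed_form1 (iter m (lie_form1 Y) (interior_product Y omega)).
Proof.
move=> [[so wT _] dw _] [sY _] LN a x cx _.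
rewrite -[RHS](LN a x cx I) iter_lie_form2E.
rewrite -(d1_iter_lie1 m (open_cod (ch a)) (sY a) (so a) (wT a) _ cx).
  by rewrite /d_form1 iter_lie_form1E.
move=> y cy i j k; have := dw a y cy I.
by move=> /(congr1 (fun f => f i j k)).
Qed.

Lemma derive_gradient (F : 'rV[R]_n -> R) (x v u : 'rV[R]_n) : differentiable F x ->
  (forall i, partial_d i F x = u 0 i) -> 'D_v F x = (v *m u^T) 0 0.
Proof.
move=> dF Fu; rewrite (derive_partials v dF) mxE.
by apply: eq_bigr => i _; rewrite Fu mxE.
Qed.

Lemma hamiltonian_pairing omega (h : M -> R) X Y m :
  symplectic_form omega -> smooth_fun setT h ->
  hamiltonian_vector_field omega h X -> infinitesimal_symmetry X Y ->
  eq_on setT (lie_fun Y h) (fun _ _ => 0) ->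
  forall a x, cod (ch a) x ->
    X a x *m (iter m (lie_form1 Y) (interior_product Y omega) a x)^T = 0.
Proof.
move=> [[so wT _] _ _] sh [[sX _] Xh] [[sY _] YX] Yh a x cx.
have oC := open_cod (ch a).
rewrite iter_lie_form1E; elim: m x cx => [|m IH] x cx.
  (* Base case: antisymmetry turns the pairing into minus dh applied to Y. *)
  rewrite /= /interior_product trmx_mul (wT a x cx) mulNmx mulmxN mulmxA.
  have := Xh a x cx I; rewrite /interior_product => ->.
  have hx : [set x | cod (ch a) x /\ setT (of_coord (ch a) x)] x by [].
  have oh : open [set x | cod (ch a) x /\ [set: M] (of_coord (ch a) x)].
    by apply: open_coord_preimage; exact: openT.
  have dh := smooth_on_differentiable oh (sh a) hx.
  have := Yh a x cx I; rewrite /lie_fun (derive_gradient (u := d_fun h a x) _ dh).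
    move=> Y0; apply/eqP; rewrite oppr_eq0; apply/eqP/matrixP => i j.
    rewrite !ord1 [RHS]mxE -Y0 !mxE; apply: eq_bigr => k _.
    by rewrite mulrC [_^T _ _]mxE [_^T _ _]mxE.
  by move=> i; rewrite mxE.
have sa := smooth_on_iter_lie1 m oC (sY a) (smooth_on_mulmx oC (sY a) (so a)).
have P := derive_pairing oC (sY a) (sX a) sa cx.
have YX0 := YX a x cx I; rewrite /lie_bracket in YX0.
rewrite YX0 mul0mx addr0 in P; rewrite iterS -P.
(* The induction hypothesis holds on the whole chart, so the paired function is locally zero and may
   be differentiated. *)
rewrite (near_eq_derive (g := cst 0)); first exact: derive_cst.
by apply: (open_near oC cx) => y cy; exact: IH.
Qed.

(** The same [U], a coordinate ball, must serve existence and uniqueness: it is star-shaped in the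
    chart, which gives both. *)
Lemma local_potential alpha (p : M) :
  is_form1 alpha -> closed_form1 alpha -> exists U : set M,
    [/\ open U, U p, exists f : M -> R, potential_on alpha U f
      & forall f g : M -> R, potential_on alpha U f -> potential_on alpha U g ->
          exists c : R, forall q, U q -> g q = f q + c].
Proof.
move=> [sa ta] da.
have [a pa] := atlas_cover p; have [cp pK] := to_coordP pa.
set x0 := to_coord (ch a) p in cp.
have /nbhs_ballP[r /= r0 Br] : nbhs x0 (cod (ch a)) by exact: (open_near (open_cod (ch a)) cp).
pose U : set M := [set q | dom (ch a) q /\ ball x0 r (to_coord (ch a) q)].
have oB : open (ball x0 r) by exact: ball_open.
have oU : open U by exact: open_chart_preimage.
have UB x : ball x0 r x -> cod (ch a) x /\ U (of_coord (ch a) x).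
  move=> Bx; have cx := Br x Bx; split => //; have [dx xK] := of_coordP cx.
  by split; rewrite ?xK.
have sB : smooth_on (ball x0 r) (alpha a) by exact: smooth_on_sub (sa a).
have [|F sF dF] := poincare_ball sB.
  by move=> x Bx; exact: da a x (Br x Bx) I.
exists U; split => //; first by split => //; exact: ballxx.
- pose f q := F (to_coord (ch a) q).
  (* In another chart [b], the primitive reads as [F] composed with the transition map; the chain
     rule and the transformation law of [alpha] match. *)
  have df b i x : cod (ch b) x /\ U (of_coord (ch b) x) ->
      is_derive x (delta_mx 0 i) (fun y => f (of_coord (ch b) y)) (alpha b x 0 i).
    move=> [cx [dx Bx]]; have ox : overlap (ch b) (ch a) x by [].
    have dphi := smooth_on_differentiable_mx (overlap_open _ _) (atlas_smooth b a) ox.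
    have dFx := smooth_on_differentiable oB sF Bx.
    have dFphi : differentiable (F \o transition (ch b) (ch a)) x.
      exact: differentiable_comp dphi dFx.
    split; first exact: (diff_derivable dFphi).
    apply: etrans (derive_comp _ dphi dFx) _.
    rewrite (derive_gradient (u := alpha a (transition (ch b) (ch a) x)) _ dFx).
      rewrite (ta b a x ox) -rowE !mxE; apply: eq_bigr => k _.
      by rewrite !mxE mulrC.
    by move=> k; have [_ <-] := dF _ k Bx.
  exists f; split=> [b|b x cx Ux].
    apply: (smooth_of_gradient (open_coord_preimage (ch b) oU) (fun i x => df b i x)).
    move=> i; apply: smooth_on_sub ((smooth_on_mxP _ (open_cod (ch b))).1 (sa b) 0 i).
    by move=> y [].
  by apply/rowP => i; rewrite mxE; have [_ <-] := df b i x (conj cx Ux).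
(* The constant is read off at [p], the centre of the ball. *)
move=> f g [sf df] [sg dg]; exists (g p - f p) => q [dq Bq].
have sub : ball x0 r `<=` [set x | cod (ch a) x /\ U (of_coord (ch a) x)] by exact: UB.
have fg x i : ball x0 r x -> partial_d i (fun y => f (of_coord (ch a) y)) x =
    partial_d i (fun y => g (of_coord (ch a) y)) x.
  move=> /UB[cx Ux]; have := etrans (df a x cx Ux) (esym (dg a x cx Ux)).
  by move=> /rowP /(_ i); rewrite !mxE.
have := gradient_eq_cst (smooth_on_sub sub (sf a)) (smooth_on_sub sub (sg a)) fg Bq.
have [_ ->] := to_coordP dq; rewrite pK => <-.
by rewrite addrC subrK.
Qed.

End Manifold.

Theorem theorem5 (R : realType) (n : nat) (M : manifold R n)
    (omega : components M 'M[R]_n) (h : M -> R)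
    (Xh Y : components M 'rV[R]_n) (N : nat)
    (hsys : regular_hamiltonian_system omega h)
    (hXh : hamiltonian_vector_field omega h Xh)
    (hN : (1 < N)%N)
    (hY : infinitesimal_noether_symmetry omega h Xh Y N) :
  let alpha := iter N.-1 (lie_form1 Y) (interior_product Y omega) in
  [/\ is_form1 alpha,
      closed_form1 alpha,
      forall p : M, exists U : set M,
        [/\ open U, U p,
            exists f : M -> R, potential_on alpha U f
          & forall f g : M -> R,
              potential_on alpha U f -> potential_on alpha U g ->
              exists c : R, forall q, U q -> g q = f q + c]
    & forall (U : set M) (f : M -> R),
        open U -> potential_on alpha U f -> conserved_on Xh U f].
Proof.
case: N hN hY => [//|m] _ [sYX LN Yh] /=; set alpha := iter m _ _.
have [sympl sh] := hsys; have [vY _] := sYX; have [fo _ _] := sympl.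
have fa : is_form1 alpha by apply: is_form1_iter_lie => //; exact: is_form1_interior.
have ca : closed_form1 alpha by exact: closed_iter_lie_interior.
split => //; first by move=> p; exact: local_potential.
(* On any open [U], differentiability of [f] makes its derivative along [Xh] the pairing of [Xh]
   with [alpha], which vanishes. *)
move=> U f oU [sf df] a x cx Ux; rewrite /lie_fun.
have ox : [set x | cod (atlas M a) x /\ U (of_coord (atlas M a) x)] x by [].
have dfx := smooth_on_differentiable (open_coord_preimage (atlas M a) oU) (sf a) ox.
rewrite (derive_gradient (u := alpha a x) _ dfx).
  by rewrite (hamiltonian_pairing m sympl sh hXh sYX Yh cx) mxE.
by move=> i; rewrite -(df a x cx Ux) mxE.
Qed.
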